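(* Let $n\ge 2$ be an integer, let $e_1,\ldots,e_k$ be non-zero projections in $\mathcal{F}_n$ such that $\sum_{j=1}^k e_j=1$, and let $A=\bigoplus_{j=1}^k e_j\mathcal{F}_n e_j$. Let $\sim$ be the equivalence relation on $\{e_1,\ldots,e_k\}$ given by $e_i\sim e_j \Leftrightarrow \tau(e_i)/\tau(e_j)\in n^{\mathbb{Z}}=\{n^m : m\in\mathbb{Z}\}$, and let $\mathcal{S}_\sim$ be the subgroup of the permutation group of $\{e_1,\ldots,e_k\}$ consisting of those permutations which leave each of the equivalence classes of $\sim$ globally invariant. Then there exists a natural group isomorphism $$\mathcal{N}_{\mathcal{O}_n}(A)\cong \mathcal{U}(A)\rtimes\mathcal{S}_\sim .$$
   Context: For an integer $n\ge 2$, the Cuntz algebra $\mathcal{O}_n$ is the $C^*$-algebra generated by isometries $S_1,\ldots,S_n$ with $\sum_{i=1}^n S_iS_i^*=1$. The circle group $U(1)$ acts on $\mathcal{O}_n$ by automorphisms $\gamma_z$ with $\gamma_z(S_i)=zS_i$; the fixed-point algebra of this action is denoted $\mathcal{F}_n$ and is a UHF-algebra of type $n^\infty$. The unique normalized trace on $\mathcal{F}_n$ is denoted $\tau$. For a unital $C^*$-algebra $B$, $\mathcal{U}(B)$ is its unitary group, and for a $C^*$-subalgebra $A\subseteq B$ the normalizer is $\mathcal{N}_B(A)=\{u\in\mathcal{U}(B): uAu^*=A\}$. ''Projection'' means self-adjoint idempotent; since the $e_j$ sum to $1$ they are mutually orthogonal, and $\bigoplus_{j} e_j\mathcal{F}_ne_j$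 denotes the internal direct sum of the corners $e_j\mathcal{F}_ne_j$, a unital $C^*$-subalgebra of $\mathcal{F}_n\subseteq\mathcal{O}_n$. The action of $\mathcal{S}_\sim$ on $\mathcal{U}(A)$ used to form the semidirect product is conjugation by unitaries of $\mathcal{O}_n$ that normalize $A$, form a group isomorphic to $\mathcal{S}_\sim$, and permute the projections $e_j$ according to the elements of $\mathcal{S}_\sim$. *)

(* Defs.v *)
From HB Require Import structures.
From mathcomp Require Import all_boot all_order all_algebra all_fingroup.
From mathcomp Require Import complex.
From mathcomp Require Import all_classical all_reals all_analysis.

Set Implicit Arguments.
Unset Strict Implicit.
Unset Printing Implicit Defensive.

Import Order.TTheory GRing.Theory Num.Theory.
Import numFieldNormedType.Exports.

Local Open Scope classical_set_scope.
Local Open Scope ring_scope.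

(* Unital C*-algebras.  The norm of MathComp-Analysis takes its values in the
   scalar field R[i]; `|1| = 1 follows from the C*-identity since 1 != 0.
   Hierarchy-Builder admits no structure joining GRing.Algebra and
   CompleteNormedModule below the existing Num.NumDomain, so the multiplication
   is a field of this mixin, and the algebra instances are declared on the sort
   of the resulting structure. *)
HB.mixin Record CompleteNormedModule_isCStar (R : realType) A
    of CompleteNormedModule R[i] A := {
  cstar_one : A;
  cstar_mul : A -> A -> A;
  star : A -> A;
  cstar_mulA : associative cstar_mul;
  cstar_mul1x : left_id cstar_one cstar_mul;
  cstar_mulx1 : right_id cstar_one cstar_mul;
  cstar_mulDl : left_distributive cstar_mul +%R;
  cstar_mulDr : right_distributive cstar_mul +%R;
  cstar_oneN0 : cstar_one != 0;
  cstar_scaleAl : forall (a : R[i]) (x y : A),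
    a *: cstar_mul x y = cstar_mul (a *: x) y;
  cstar_scaleAr : forall (a : R[i]) (x y : A),
    a *: cstar_mul x y = cstar_mul x (a *: y);
  starK : involutive star;
  starD : {morph star : x y / x + y};
  starZ : forall (a : R[i]) (x : A), star (a *: x) = a^* *: star x;
  starM_subproof : forall x y : A,
    star (cstar_mul x y) = cstar_mul (star y) (star x);
  normM_subproof : forall x y : A, `|cstar_mul x y| <= `|x| * `|y|;
  normE_subproof : forall x : A, `|cstar_mul (star x) x| = `|x| ^+ 2
}.

#[short(type="cstarType")]
HB.structure Definition CStar (R : realType) :=
  {A of CompleteNormedModule R[i] A & CompleteNormedModule_isCStar R A}.

Section CStarAlgebra.
Context (R : realType) (B : cstarType R).

#[non_forgetful_inheritance]
HB.instance Definition _ := GRing.Zmodule_isNzRing.Build (CStar.sort B)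
  (@cstar_mulA R B) (@cstar_mul1x R B) (@cstar_mulx1 R B)
  (@cstar_mulDl R B) (@cstar_mulDr R B) (@cstar_oneN0 R B).
#[non_forgetful_inheritance]
HB.instance Definition _ :=
  GRing.Lmodule_isLalgebra.Build R[i] (CStar.sort B) (@cstar_scaleAl R B).
#[non_forgetful_inheritance]
HB.instance Definition _ :=
  GRing.Lalgebra_isAlgebra.Build R[i] (CStar.sort B) (@cstar_scaleAr R B).

Lemma starM (x y : B) : star (x * y) = star y * star x.
Proof. exact: starM_subproof. Qed.
Lemma cstar_normM (x y : B) : `|x * y| <= `|x| * `|y|.
Proof. exact: normM_subproof. Qed.
Lemma cstar_normE (x : B) : `|star x * x| = `|x| ^+ 2.
Proof. exact: normE_subproof. Qed.
End CStarAlgebra.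

Section CStarTheory.
Context (R : realType) (B : cstarType R).
Implicit Types (x y : B) (A F D : set B).

Record cstar_subalgebra D : Prop := {
  csub_closed : closed D;
  csub_0 : D 0;
  csub_lin : forall (a : R[i]) x y, D x -> D y -> D (a *: x + y);
  csub_mul : forall x y, D x -> D y -> D (x * y);
  csub_star : forall x, D x -> D (star x)
}.

Definition generates n (S : 'I_n -> B) : Prop :=
  forall D, cstar_subalgebra D -> (forall i, D (S i)) -> D = setT.

(* For 2 <= n these conditions determine (B, S) up to isomorphism, by Cuntz's
   uniqueness theorem: B is O_n. *)
Record is_cuntz n (S : 'I_n -> B) : Prop := {
  cuntz_isometry : forall i, star (S i) * S i = 1;
  cuntz_sum : \sum_(i < n) S i * star (S i) = 1;
  cuntz_generates : generates S
}.

Record star_automorphism (f : B -> B) : Prop := {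
  saut_linear : linear f;
  saut_mul : {morph f : x y / x * y};
  saut_star : {morph f : x / star x};
  saut_bij : bijective f
}.

(* gamma z is only constrained for z in U(1). *)
Record gauge_action n (S : 'I_n -> B) (gamma : R[i] -> B -> B) : Prop := {
  gauge_aut : forall z, `|z| = 1 -> star_automorphism (gamma z);
  gauge_1 : gamma 1 =1 id;
  gauge_mul : forall z w, `|z| = 1 -> `|w| = 1 ->
    gamma (z * w) =1 gamma z \o gamma w;
  gauge_gen : forall z i, `|z| = 1 -> gamma z (S i) = z *: S i
}.

Definition fixed_algebra (gamma : R[i] -> B -> B) : set B :=
  [set x | forall z, `|z| = 1 -> gamma z x = x].

(* tau is a total function, but only its restriction to F matters. *)
Record normalized_trace F (tau : B -> R[i]) : Prop := {
  trace_linear : forall (a : R[i]) x y, F x -> F y ->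
    tau (a *: x + y) = a * tau x + tau y;
  trace_ge0 : forall x, F x -> 0 <= tau (star x * x);
  trace_1 : tau 1 = 1;
  trace_comm : forall x y, F x -> F y -> tau (x * y) = tau (y * x)
}.

Definition projection x : Prop := star x = x /\ x * x = x.

Definition corner_sum F k (e : 'I_k -> B) : set B :=
  [set x | exists2 y : 'I_k -> B, (forall j, F (y j)) &
     x = \sum_(j < k) e j * y j * e j].

Record unitary := Unitary {
  uval :> B;
  unitary_proof : (star uval * uval == 1) && (uval * star uval == 1) }.

HB.instance Definition _ := [isSub for uval].
HB.instance Definition _ := [Choice of unitary by <:].

Lemma star1 : star (1 : B) = 1.
Proof. by rewrite -[LHS]mulr1 -[X in _ * X]starK -starM mulr1 starK. Qed.

Lemma unitary_one_subproof : (star (1 : B) * 1 == 1) && (1 * star (1 : B) == 1).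
Proof. by rewrite star1 mulr1 eqxx. Qed.

Lemma unitary_mul_subproof (u v : unitary) :
  (star (uval u * uval v) * (uval u * uval v) == 1) &&
  (uval u * uval v * star (uval u * uval v) == 1).
Proof.
case: u v => [u /andP[/eqP u1 /eqP u2]] [v /andP[/eqP v1 /eqP v2]] /=.
rewrite starM -mulrA (mulrA _ u) u1 mul1r v1 eqxx /=.
by rewrite -mulrA (mulrA v) v2 mul1r u2.
Qed.

Lemma unitary_inv_subproof (u : unitary) :
  (star (star (uval u)) * star (uval u) == 1) &&
  (star (uval u) * star (star (uval u)) == 1).
Proof. by rewrite starK andbC; case: u. Qed.

Definition unitary_one := Unitary unitary_one_subproof.
Definition unitary_mul u v := Unitary (unitary_mul_subproof u v).
Definition unitary_inv u := Unitary (unitary_inv_subproof u).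

Lemma unitary_mulA : associative unitary_mul.
Proof. by move=> u v w; apply: val_inj; rewrite /= mulrA. Qed.
Lemma unitary_mul1u : left_id unitary_one unitary_mul.
Proof. by move=> u; apply: val_inj; rewrite /= mul1r. Qed.
Lemma unitary_mulu1 : right_id unitary_one unitary_mul.
Proof. by move=> u; apply: val_inj; rewrite /= mulr1. Qed.
Lemma unitary_mulVu : left_inverse unitary_one unitary_inv unitary_mul.
Proof. by case=> u uP; apply: val_inj; case/andP: (uP) => /eqP. Qed.
Lemma unitary_muluV : right_inverse unitary_one unitary_inv unitary_mul.
Proof. by case=> u uP; apply: val_inj; case/andP: (uP) => _ /eqP. Qed.

HB.instance Definition _ := isGroup.Build unitary
  unitary_mulA unitary_mul1u unitary_mulu1 unitary_mulVu unitary_muluV.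

End CStarTheory.

Section Subgroup.
Context (G : groupType).

Record subgroup := Subgroup {
  subgroup_set :> set G;
  subgroup_proof : group_closed (mem subgroup_set) }.

Record subgroup_type (H : subgroup) := SubgroupElt {
  subgroup_val :> G;
  subgroup_valP : subgroup_val \in subgroup_set H }.

Context (H : subgroup).

HB.instance Definition _ :=
  [isSub of subgroup_type H for @subgroup_val H].
HB.instance Definition _ := [Choice of subgroup_type H by <:].
HB.instance Definition _ := SubChoice_isSubGroup.Build G _ (subgroup_type H)
  (subgroup_proof H).
End Subgroup.

Coercion subgroup_type : subgroup >-> Sortclass.

Section Normalizer.
Context (R : realType) (B : cstarType R) (A : set B).

(* U(A) for a unital *-subalgebra A of B. *)
Definition unitaries_in : set (unitary B) := [set u | A (uval u)].

Definition normalizer_set : set (unitary B) :=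
  [set u | [set uval u * a * star (uval u) | a in A] = A].

Lemma normalizer_group : group_closed (mem normalizer_set).
Proof.
split=> [|u v]; rewrite ?inE.
  rewrite /normalizer_set /= star1; apply/seteqP; split=> [_ [a Aa <-]|a Aa].
    by rewrite mul1r mulr1.
  by exists a; rewrite ?mul1r ?mulr1.
rewrite /normalizer_set /= => uA vA.
have vV : [set star (uval v) * a * uval v | a in A] = A.
  case: v vA => v /= /andP[/eqP v1 /eqP v2] vA.
  rewrite -[in LHS]vA; apply/seteqP; split=> [x|x Ax].
    by move=> [_ [a Aa <-]] <-; rewrite !mulrA v1 mul1r -mulrA v1 mulr1.
  exists (v * x * star v); first by exists x.
  by rewrite !mulrA v1 mul1r -mulrA v1 mulr1.
rewrite -[RHS]uA -[in RHS]vV; apply/seteqP; split=> [x|x].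
  move=> [a Aa <-]; exists (star (uval v) * a * uval v); first by exists a.
  by rewrite starM starK !mulrA.
move=> [_ [a Aa <-]] <-; exists a => //.
by rewrite starM starK !mulrA.
Qed.

Definition normalizer : subgroup (unitary B) := Subgroup normalizer_group.

End Normalizer.

(* Permutations of 'I_k composed right to left, (s * t) j = s (t j), whereas
   the product of 'S_k composes left to right. *)
Section Sym.
Context (k : nat).

Definition sym : Type := 'S_k.
Definition sym_fun (s : sym) : 'I_k -> 'I_k := fun j => (s : 'S_k) j.

HB.instance Definition _ := Choice.copy sym 'S_k.

Definition sym_mul (s t : sym) : sym := ((t : 'S_k) * (s : 'S_k))%g.

Lemma sym_mulA : associative sym_mul.
Proof. by move=> s t u; rewrite /sym_mul mulgA. Qed.
Lemma sym_mul1s : left_id (1%g : 'S_k) sym_mul.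
Proof. by move=> s; rewrite /sym_mul mulg1. Qed.
Lemma sym_muls1 : right_id (1%g : 'S_k) sym_mul.
Proof. by move=> s; rewrite /sym_mul mul1g. Qed.
Lemma sym_mulVs : left_inverse (1%g : 'S_k) (fun s : 'S_k => s^-1%g) sym_mul.
Proof. by move=> s; rewrite /sym_mul mulgV. Qed.
Lemma sym_mulsV : right_inverse (1%g : 'S_k) (fun s : 'S_k => s^-1%g) sym_mul.
Proof. by move=> s; rewrite /sym_mul mulVg. Qed.

HB.instance Definition _ :=
  isGroup.Build sym sym_mulA sym_mul1s sym_muls1 sym_mulVs sym_mulsV.

End Sym.

Coercion sym_fun : sym >-> Funclass.

Section ClassPreserving.
Context (k : nat) (sim : 'I_k -> 'I_k -> Prop).

Definition class_perms_set : set (sym k) :=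
  [set s | forall i, [set s j | j in [set j | sim i j]] = [set j | sim i j]].

Lemma class_perms_group : group_closed (mem class_perms_set).
Proof.
split=> [|s t]; rewrite ?inE.
  move=> i; apply/seteqP; split=> [_ [j ij <-]|j ij].
    by rewrite /sym_fun perm1.
  by exists j => //; rewrite /sym_fun perm1.
move=> sP tP i; rewrite -[RHS]sP.
apply/seteqP; split=> [_ [j ij <-]|_ [j ij <-]]; rewrite /sym_fun.
  exists ((t : 'S_k)^-1%g j); last by rewrite permM.
  have : [set j | sim i j] j by [].
  by rewrite -{1}(tP i) => -[l il <-]; rewrite /sym_fun permK.
exists ((t : 'S_k) j); last by rewrite permM permK.
have : [set t l | l in [set l | sim i l]] (t j) by exists j.
by rewrite (tP i).
Qed.

Definition class_perms : subgroup (sym k) := Subgroup class_perms_group.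

End ClassPreserving.

Section Semidirect.
Context (G H : groupType).

(* Actions of H on G by group endomorphisms, hence automorphisms. *)
Record group_action := GroupAction {
  gact :> H -> G -> G;
  gactM : forall h, {morph gact h : x y / (x * y)%g};
  gact1 : forall x, gact 1%g x = x;
  gact_comp : forall h h' x, gact (h * h')%g x = gact h (gact h' x) }.

Context (alpha : group_action).

Definition semidirect of group_action : Type := (G * H)%type.
Local Notation sd := (semidirect alpha).

HB.instance Definition _ := Choice.copy sd (G * H)%type.

Definition sd_one : sd := (1%g, 1%g).
Definition sd_mul (p q : sd) : sd :=
  ((p.1 * alpha p.2 q.1)%g, (p.2 * q.2)%g).
Definition sd_inv (p : sd) : sd := (alpha p.2^-1%g p.1^-1%g, p.2^-1%g).

Lemma sd_mulA : associative sd_mul.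
Proof.
by move=> [a g] [b h] [c l]; rewrite /sd_mul /= gactM gact_comp !mulgA.
Qed.
Lemma gact_one h : alpha h 1%g = 1%g.
Proof. by apply: (mulgI (alpha h 1%g)); rewrite -gactM !mulg1. Qed.
Lemma sd_mul1p : left_id sd_one sd_mul.
Proof. by move=> [a g]; rewrite /sd_mul /= gact1 !mul1g. Qed.
Lemma sd_mulp1 : right_id sd_one sd_mul.
Proof. by move=> [a g]; rewrite /sd_mul /= gact_one !mulg1. Qed.
Lemma sd_mulVp : left_inverse sd_one sd_inv sd_mul.
Proof. by move=> [a g]; rewrite /sd_mul /= -gactM !mulVg gact_one. Qed.
Lemma sd_mulpV : right_inverse sd_one sd_inv sd_mul.
Proof.
by move=> [a g]; rewrite /sd_mul /= -gact_comp !mulgV gact1 mulgV.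
Qed.

HB.instance Definition _ :=
  isGroup.Build sd sd_mulA sd_mul1p sd_mulp1 sd_mulVp sd_mulpV.

End Semidirect.

(* e is injective in the intended use, so the relation on {e_1, ..., e_k} and
   its permutations are stated on indices. *)
Definition trace_equiv (R : realType) (B : cstarType R) (n : nat)
    (tau : B -> R[i]) (k : nat) (e : 'I_k -> B) (i j : 'I_k) : Prop :=
  exists m : int, tau (e i) / tau (e j) = n%:R ^ m.

(* Main.v *)
Require Import Defs.
From HB Require Import structures.
From mathcomp Require Import all_boot all_order all_algebra all_fingroup.
From mathcomp Require Import complex.
From mathcomp Require Import all_classical all_reals all_analysis.
From mathcomp Require Import ring lra.
Set Implicit Arguments.
Unset Strict Implicit.
Unset Printing Implicit Defensive.
Import Order.TTheory GRing.Theory Num.Theory.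
Import numFieldNormedType.Exports.
Local Open Scope classical_set_scope.
Local Open Scope ring_scope.

(* Everything is elementary C*-algebra.  Fixed points of contractions give
   Neumann inverses and square roots of 1 - a, hence unitaries h + i sqrt(1 - h^2);
   so unital *-homomorphisms are contractive, and projections with sum 1 are
   orthogonal.  The fixed-point algebra F is the closure of the union of the
   matrix algebras spanned by the S_v S_w^* with |v| = |w| = r, projections of F
   are classified by tau, and tau(S_1^m x S_1^{*m}) = n^-m tau(x).  Compressing by
   the aperiodic word 1^m 2 gives F' = C in O_n, whence (eFe)' = C e in e O_n e.

   If u normalizes A, then u permutes the minimal central projections e_j of A.
   If u e_j u^* = e_i, put v = u e_j.  Since v^* gamma_z(v) commutes with e_j F e_j,
   gamma_z(v) is a multiple of v for every z, which forces v to be homogeneous of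
   some degree m: either v S_1^{*m} or v^* S_1^{*m} is in F.  Hence
   tau(e_i) / tau(e_j) is a power of n, and v is in F if i = j.  Conversely, if
   tau(e_i) = n^m tau(e_j), then S_1^m e_i S_1^{*m} is equivalent to e_j in F, which
   gives a partial isometry from e_i to e_j exchanging the corners.  Fixing such
   v_j from a representative of the class of j to e_j, the unitaries
   sum_j v_{s j} v_j^* split the extension. *)

(** * Identities of noncommutative rings *)

Section NoncommutativeRing.

(** Neither functional calculus nor integration enters. Positivity appears only as explicit square
    roots, and each root or inverse is found by iteration inside a closed set [D], so that it
    inherits membership in F, self-adjointness and commutation relations. Averages over the 2^K-th
    roots of unity stand in for the Haar integral of the circle, and the density of the matrix
    algebras in F comes out of them. The eigenvalues of v = u e_j are likewise examined only at a
    coherent sequence of such roots: successive square roots starting at 1 either stay 1 or meet -1,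
    and in the second case the averages vanish. A monomial that survives averaging against v
    therefore fixes the degree of v.

    For the splitting it is not enough to have a partial isometry for each pair of equivalent
    projections: these must compose. Routing all of them through one representative of each class
    makes v_{s j} v_j^* telescope, so the lift of s is multiplicative. The isomorphism is then (u,
    s) -> u V_s, and s is recovered from the way u V_s permutes the e_j. *)

Inductive ncexpr :=
  | NCvar of nat | NCzero | NCone | NCopp of ncexpr
  | NCadd of ncexpr & ncexpr | NCmul of ncexpr & ncexpr.

Fixpoint nceval (A : pzRingType) (env : seq A) (t : ncexpr) : A :=
  match t with
  | NCvar i => env`_i | NCzero => 0 | NCone => 1 | NCopp t => - nceval env t
  | NCadd t u => nceval env t + nceval env u
  | NCmul t u => nceval env t * nceval env u
  end.

Definition ncmono := (bool * seq nat)%type.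

Fixpoint ncnorm (t : ncexpr) : seq ncmono :=
  match t with
  | NCvar i => [:: (false, [:: i])] | NCzero => [::] | NCone => [:: (false, [::])]
  | NCopp t => [seq (~~ m.1, m.2) | m <- ncnorm t]
  | NCadd t u => ncnorm t ++ ncnorm u
  | NCmul t u => [seq (m.1 (+) p.1, m.2 ++ p.2) | m <- ncnorm t, p <- ncnorm u]
  end.

(** Coefficients are never collected: a sum of signed words is recognized as zero by pairing each
    word with its negative. Each step consumes two words, so the length of the list is fuel
    enough. *)
Fixpoint nccancel (l : seq ncmono) (fuel : nat) : bool :=
  match l, fuel with
  | [::], _ => true
  | m :: l, fuel.+1 =>
    ((~~ m.1, m.2) \in l) && nccancel (rem (~~ m.1, m.2) l) fuel
  | _, _ => false
  end.

Context (A : pzRingType) (env : seq A).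

Let val (m : ncmono) : A := (-1) ^+ m.1 * \prod_(i <- m.2) env`_i.

Lemma nceval_norm t : nceval env t = \sum_(m <- ncnorm t) val m.
Proof.
elim: t => [i|||t IH|t IHt u IHu|t IHt u IHu] /=.
- by rewrite !big_seq1 /val expr0 mul1r big_seq1.
- by rewrite big_nil.
- by rewrite big_seq1 /val expr0 mul1r big_nil.
- rewrite IH big_map -sumrN; apply: eq_bigr => m _.
  by rewrite /val /= signrN mulNr.
- by rewrite big_cat IHt IHu.
- rewrite IHt IHu big_allpairs_dep mulr_suml; apply: eq_bigr => m _.
  rewrite mulr_sumr; apply: eq_bigr => p _.
  rewrite /val /= signr_addb big_cat /= -!mulrA; congr (_ * _).
  by rewrite !mulrA; congr (_ * _); apply: commr_sign.
Qed.

Lemma nccancel_sound l fuel : nccancel l fuel -> \sum_(m <- l) val m = 0.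
Proof.
elim: fuel l => [|fuel IH] [|m l] //=; rewrite ?big_nil // => /andP[ml /IH l0].
rewrite big_cons (perm_big _ (perm_to_rem ml)) /= big_cons l0 addr0.
by rewrite /val /= signrN mulNr subrr.
Qed.

Lemma ncring_sound t u :
  (let l := ncnorm (NCadd t (NCopp u)) in nccancel l (size l)) ->
  nceval env t = nceval env u.
Proof.
move=> /nccancel_sound; rewrite -nceval_norm /= => /eqP.
by rewrite subr_eq0 => /eqP.
Qed.

End NoncommutativeRing.

Ltac nc_index x env :=
  match env with
  | x :: _ => constr:(0%N)
  | _ :: ?l => let i := nc_index x l in constr:(i.+1)
  end.
Ltac nc_insert x env :=
  match env with
  | context [x :: _] => env
  | _ => constr:(x :: env)
  end.
(** Whatever is not a ring operation is an atom, [c *: x] included, so identities that use linearity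
    of scaling need a preliminary rewriting. *)
Ltac nc_atoms t env :=
  lazymatch t with
  | @GRing.mul _ ?a ?b => let e := nc_atoms a env in nc_atoms b e
  | @Algebra.add _ ?a ?b => let e := nc_atoms a env in nc_atoms b e
  | @Algebra.opp _ ?a => nc_atoms a env
  | @GRing.one _ => env
  | @Algebra.zero _ => env
  | _ => nc_insert t env
  end.
Ltac nc_reify t env :=
  lazymatch t with
  | @GRing.mul _ ?a ?b =>
    let u := nc_reify a env in let v := nc_reify b env in constr:(NCmul u v)
  | @Algebra.add _ ?a ?b =>
    let u := nc_reify a env in let v := nc_reify b env in constr:(NCadd u v)
  | @Algebra.opp _ ?a => let u := nc_reify a env in constr:(NCopp u)
  | @GRing.one _ => constr:(NCone)
  | @Algebra.zero _ => constr:(NCzero)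
  | _ => let i := nc_index t env in constr:(NCvar i)
  end.
Ltac ncring :=
  lazymatch goal with
  | |- @eq ?T ?a ?b =>
    let env := nc_atoms a (@nil T) in
    let env := nc_atoms b env in
    let u := nc_reify a env in
    let v := nc_reify b env in
    exact: (@ncring_sound _ env u v isT)
  end.

(** * The real-valued norm *)

Section Norm.
Context (R : realType) (O : cstarType R).
Implicit Types x y : O.

Lemma half2 x : (2^-1 : R[i]) *: (x + x) = x.
Proof. by rewrite -mulr2n -(scaler_nat 2 x) scalerA mulVf ?scale1r ?pnatr_eq0. Qed.

(** The norm has values in [R[i]]; its real part lives in [R], where [lra] and [nra] apply. *)
Definition nrm x : R := complex.Re `|x|.

Lemma nrmE x : `|x| = (nrm x)%:C%C.
Proof. by rewrite RRe_real // normr_real. Qed.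

Lemma rcle (a b : R) : (a%:C%C <= b%:C%C) = (a <= b).
Proof. by rewrite lecE /= eqxx. Qed.
Lemma rclt (a b : R) : (a%:C%C < b%:C%C) = (a < b).
Proof. by rewrite ltcE /= eqxx. Qed.

Lemma rcI (a b : R) : a%:C%C = b%:C%C -> a = b.
Proof. by move/(congr1 (@complex.Re R)). Qed.

Lemma rcgt0 (a : R) : (0 < a%:C%C) = (0 < a).
Proof. by rewrite ltcE /= eqxx. Qed.

Lemma nrm_ge0 x : 0 <= nrm x.
Proof. by rewrite -rcle -nrmE rmorph0 normr_ge0. Qed.

Lemma nrm0 : nrm 0 = 0.
Proof. by rewrite /nrm normr0. Qed.

Lemma nrm_eq0 x : nrm x = 0 -> x = 0.
Proof. by move=> x0; apply/normr0_eq0; rewrite nrmE x0. Qed.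

Lemma nrmD x y : nrm (x + y) <= nrm x + nrm y.
Proof. by rewrite -rcle rmorphD/= -!nrmE ler_normD. Qed.

Lemma nrmN x : nrm (- x) = nrm x.
Proof. by rewrite /nrm normrN. Qed.

Lemma nrmB x y : nrm (x - y) <= nrm x + nrm y.
Proof. by rewrite -(nrmN y) nrmD. Qed.

Lemma nrmBC x y : nrm (x - y) = nrm (y - x).
Proof. by rewrite -nrmN opprB. Qed.

Lemma nrmM x y : nrm (x * y) <= nrm x * nrm y.
Proof. by rewrite -rcle rmorphM/= -!nrmE cstar_normM. Qed.

Lemma nrm_starx x : nrm (star x * x) = nrm x ^+ 2.
Proof. by apply: rcI; rewrite -nrmE cstar_normE nrmE rmorphXn. Qed.

Lemma nrmZ (c : R[i]) x : nrm (c *: x) = complex.Re `|c| * nrm x.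
Proof.
apply: rcI; rewrite rmorphM/= -!nrmE normrZ; congr (_ * _).
Qed.

Lemma nrmZr (a : R) x : 0 <= a -> nrm (a%:C%C *: x) = a * nrm x.
Proof. by move=> a0; rewrite nrmZ ger0_norm // ler0c. Qed.

Lemma nrmZ1 (c : R[i]) x : `|c| = 1 -> nrm (c *: x) = nrm x.
Proof. by move=> c1; rewrite nrmZ c1 mul1r. Qed.

Lemma nrmZh x : nrm ((2^-1 : R[i]) *: x) = 2^-1 * nrm x.
Proof.
have -> : (2^-1 : R[i]) = (2^-1 : R)%:C%C by rewrite fmorphV rmorph_nat.
by rewrite nrmZr // invr_ge0.
Qed.

Lemma nrm_starle x : nrm x <= nrm (star x).
Proof.
have [->//|x0] := eqVneq x 0; first by rewrite nrm0 nrm_ge0.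
have xp : 0 < nrm x.
  by rewrite lt_neqAle nrm_ge0 andbT eq_sym; apply: contra_neq x0; apply: nrm_eq0.
by rewrite -(ler_pM2r xp) -expr2 -nrm_starx nrmM.
Qed.

Lemma nrm_star x : nrm (star x) = nrm x.
Proof. by apply/le_anti; rewrite nrm_starle -{2}(starK x) nrm_starle. Qed.

Lemma nrm_sa x : star x = x -> nrm (x * x) = nrm x ^+ 2.
Proof. by move=> xs; rewrite -nrm_starx xs. Qed.

Lemma star0 : star 0 = 0 :> O.
Proof. by rewrite -[X in star X](scale0r (0 : O)) starZ conjC0 scale0r. Qed.

Lemma starN x : star (- x) = - star x.
Proof. by apply/eqP; rewrite -addr_eq0 -starD addNr star0. Qed.

Lemma starB x y : star (x - y) = star x - star y.
Proof. by rewrite starD starN. Qed.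

Lemma star_sum (I : Type) (r : seq I) (P : pred I) (f : I -> O) :
  star (\sum_(i <- r | P i) f i) = \sum_(i <- r | P i) star (f i).
Proof. by apply: (big_morph star (@starD R O) star0). Qed.

Lemma nrm1 : nrm 1 = 1.
Proof.
have := nrm_starx 1; rewrite star1 mulr1 => /eqP.
rewrite expr2 -[X in X == _]mulr1 => /eqP; apply: contraPeq => n1; apply/eqP.
rewrite eq_sym (inj_eq (mulfI _)) //.
apply/eqP => /nrm_eq0/eqP; rewrite oner_eq0 //.
Qed.

Definition nclosed (D : set O) :=
  forall x, (forall d : R, 0 < d -> exists2 y, D y & nrm (x - y) < d) -> D x.

Lemma nclosedP (D : set O) : nclosed D <-> closed D.
Proof.
split=> [Dc x Dx|Dc x Dx].
  apply: Dc => d d0.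
  have /Dx[y [Dy]] : nbhs x (ball x d%:C%C) by apply: nbhsx_ballx; rewrite rcgt0.
  by rewrite -ball_normE /= nrmE rclt => xy; exists y.
apply: Dc => B /nbhs_ballP[d /= d0].
rewrite -ball_normE => dB.
have dR : d = (complex.Re d)%:C%C by rewrite RRe_real // gtr0_real.
have [|y Dy xy] := Dx (complex.Re d); first by rewrite -rcgt0 -dR.
by exists y; split => //; apply: dB; rewrite /= nrmE dR rclt.
Qed.

Lemma cauchy_limit (u : nat -> O) :
  (forall d : R, 0 < d -> exists N, forall m p, (N <= m)%N -> (N <= p)%N ->
     nrm (u m - u p) < d) ->
  exists l, forall d : R, 0 < d -> exists N, forall m, (N <= m)%N -> nrm (l - u m) < d.
Proof.
move=> uC.
have /cauchy_cvgP : cauchy (u @ \oo).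
  apply/cauchy_ballP => d d0.
  have dR : d = (complex.Re d)%:C%C by rewrite RRe_real // gtr0_real.
  have [|N NP] := uC (complex.Re d); first by rewrite -rcgt0 -dR.
  near=> z; near: z.
  exists ([set x | exists2 m, (N <= m)%N & x = u m], [set x | exists2 m, (N <= m)%N & x = u m]).
    by split; exists N => //= m /= Nm; exists m.
  move=> [a b] /= [[m Nm ->] [p Np ->]].
  by rewrite -ball_normE /= nrmE dR rclt NP.
move=> /cvg_ballP uc; exists (lim (u @ \oo)) => d d0.
have /uc[N _ NP] : (0 : R[i]) < d%:C%C by rewrite rcgt0.
by exists N => m Nm; have := NP m Nm; rewrite -ball_normE /= nrmE rclt.
Unshelve. all: by end_near.
Qed.

End Norm.

(** * Fixed points of contractions *)

Section Fix.
Context (R : realType) (O : cstarType R).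
Implicit Types (x y z a b c w : O) (D : set O).

Lemma geometric_small (q M d : R) : 0 <= q < 1 -> 0 < d ->
  exists N, forall m, (N <= m)%N -> M * q ^+ m < d.
Proof.
move=> /andP[q0 q1] d0.
have q1' : `|q| < 1 by rewrite ger0_norm.
have /(@cvgr_dist_lt _ R^o)/(_ _ d0)[N _ NP] := cvg_geometric M q1'.
exists N => m /NP /=; rewrite sub0r normrN; exact: le_lt_trans (ler_norm _).
Qed.

Lemma nrm_small x : (forall d : R, 0 < d -> nrm x <= d) -> x = 0.
Proof.
move=> xs; apply: nrm_eq0; apply: le_anti; rewrite nrm_ge0 andbT.
by apply/ler_addgt0Pr => d d0; rewrite add0r xs.
Qed.

Lemma nrm_tri y x z : nrm (x - z) <= nrm (x - y) + nrm (y - z).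
Proof. by have := nrmD (x - y) (y - z); rewrite addrA subrK. Qed.

(** Banach's fixed point theorem inside a closed set. Later [D] records the algebraic side
    conditions of the solution, which then need no separate limiting argument. *)
Lemma contraction_fix D (f : O -> O) (q : R) x0 :
  nclosed D -> D x0 -> (forall x, D x -> D (f x)) -> 0 <= q < 1 ->
  (forall x y, D x -> D y -> nrm (f x - f y) <= q * nrm (x - y)) ->
  exists2 x, D x & f x = x.
Proof.
move=> Dc Dx0 Df /andP[q0 q1] fq.
pose u m := iter m f x0.
have Du m : D (u m) by elim: m => //= m; apply: Df.
(* The sum of the geometric series with first term [nrm (f x0 - x0)] and ratio q bounds the distance
   of every iterate from x0. *)
pose M := nrm (f x0 - x0) / (1 - q).
have q1p : 0 < 1 - q by rewrite subr_gt0.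
have M0 : 0 <= M by rewrite divr_ge0 ?nrm_ge0 // ltW.
have u0 k : nrm (u k - x0) <= M.
  elim: k => [|k IH] /=; first by rewrite subrr nrm0.
  have h1 := nrm_tri (f x0) (f (u k)) x0.
  have h2 := fq _ _ (Du k) Dx0.
  have h3 : nrm (f x0 - x0) = M * (1 - q) by rewrite /M divfK // gt_eqF.
  have h4 : q * nrm (u k - x0) <= q * M by rewrite ler_wpM2l.
  rewrite h3 in h1; lra.
have uk m k : nrm (u (m + k)%N - u m) <= M * q ^+ m.
  elim: m k => [|m IH] k; first by rewrite expr0 mulr1 u0.
  rewrite addSn /=; apply: le_trans (fq _ _ (Du _) (Du _)) _.
  by rewrite exprS mulrCA ler_wpM2l.
have [|l lP] := @cauchy_limit _ _ u.
  move=> d d0; have q01 : 0 <= q < 1 by rewrite q0.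
  have [N NP] := geometric_small (2 * M) q01 d0.
  exists N => m p Nm Np; apply: le_lt_trans (NP N (leqnn N)).
  apply: le_trans (nrm_tri (u N) _ _) _.
  have := uk N (m - N)%N; have := uk N (p - N)%N.
  rewrite !subnKC // [nrm (u N - _)]nrmBC; lra.
have Dl : D l by apply: Dc => d /lP[N NP]; exists (u N); [exact: Du | exact: NP].
exists l => //; apply/eqP; rewrite -subr_eq0; apply/eqP/nrm_small => d d0.
have [N NP] := lP (d / 2) ltac:(lra).
have h1 := NP N (leqnn N); have h2 := NP N.+1 (leqnSn N).
apply: le_trans (nrm_tri (u N.+1) _ _) _; rewrite [nrm (u N.+1 - _)]nrmBC.
have h3 := fq _ _ Dl (Du N).
have : q * nrm (l - u N) <= 1 * nrm (l - u N) by rewrite ler_wpM2r ?nrm_ge0 // ltW.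
rewrite mul1r /= in h1 h2 h3 *; lra.
Qed.

Definition lip (f : O -> O) :=
  exists C : R, forall x y, nrm (f x - f y) <= C * nrm (x - y).

Lemma lip_pos f : lip f -> exists2 C : R, 0 < C & forall x y, nrm (f x - f y) <= C * nrm (x - y).
Proof.
case=> C CP; exists (`|C| + 1) => [|x y]; first by rewrite ltr_wpDl.
apply: le_trans (CP x y) _; rewrite ler_wpM2r ?nrm_ge0 //.
by rewrite (le_trans (ler_norm _)) // lerDl.
Qed.

Lemma lip_id : lip id. Proof. by exists 1 => x y; rewrite mul1r. Qed.
Lemma lip_cst c : lip (fun=> c).
Proof. by exists 0 => x y; rewrite subrr nrm0 mul0r. Qed.
Lemma lip_mull a f : lip f -> lip (fun x => a * f x).
Proof.
case=> C CP; exists (nrm a * C) => x y; rewrite -mulrBr -mulrA.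
by apply: le_trans (nrmM _ _) _; rewrite ler_wpM2l ?nrm_ge0.
Qed.
Lemma lip_mulr a f : lip f -> lip (fun x => f x * a).
Proof.
case=> C CP; exists (C * nrm a) => x y; rewrite -mulrBl mulrAC.
by apply: le_trans (nrmM _ _) _; rewrite ler_wpM2r ?nrm_ge0.
Qed.
Lemma lip_star f : lip f -> lip (fun x => star (f x)).
Proof. by case=> C CP; exists C => x y; rewrite -starB nrm_star. Qed.
Lemma lip_scale (c : R[i]) f : lip f -> lip (fun x => c *: f x).
Proof.
case=> C CP; exists (complex.Re `|c| * C) => x y; rewrite -scalerBr nrmZ -mulrA.
by rewrite ler_wpM2l // -rcle rmorph0 RRe_real ?normr_ge0 ?normr_real.
Qed.
Lemma lip_add f g : lip f -> lip g -> lip (fun x => f x + g x).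
Proof.
move=> [C CP] [C' CP']; exists (C + C') => x y.
rewrite opprD addrACA mulrDl; apply: le_trans (nrmD _ _) _.
exact: lerD.
Qed.
Lemma nclosed_preim D f : nclosed D -> lip f -> nclosed (fun x => D (f x)).
Proof.
move=> Dc /lip_pos[C C0 CP] x Dx; apply: Dc => d d0.
have [y Dy xy] := Dx (d / C) (divr_gt0 d0 C0).
by exists (f y) => //; apply: le_lt_trans (CP _ _) _; rewrite mulrC -ltr_pdivlMr.
Qed.

Lemma nclosed_eq f g : lip f -> lip g -> nclosed (fun x => f x = g x).
Proof.
move=> fl gl.
have [C C0 CP] : exists2 C : R, 0 < C & forall x y, nrm ((f x - g x) - (f y - g y)) <= C * nrm (x - y).
  apply: (@lip_pos (fun x => f x - g x)).
  have [C CP] := gl; apply: lip_add => //; exists C => x y.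
  by rewrite -opprD nrmN.
move=> x Dx; apply/eqP; rewrite -subr_eq0; apply/eqP/nrm_small => d d0.
have [y Dy xy] := Dx (d / C) (divr_gt0 d0 C0).
have := CP x y; rewrite Dy subrr subr0 => /le_trans -> //.
by rewrite mulrC -ler_pdivlMr // ltW.
Qed.

Lemma nclosedI D D' : nclosed D -> nclosed D' -> nclosed (fun x => D x /\ D' x).
Proof.
by move=> Dc Dc' x Dx; split; [apply: Dc|apply: Dc'] => d /Dx[y []]; exists y.
Qed.

Lemma nclosed_ball (c : R) : nclosed (fun x => nrm x <= c).
Proof.
move=> x xP; apply/ler_addgt0Pr => d /xP[y yc xy].
by rewrite -(subrK y x); apply: le_trans (nrmD _ _) _; lra.
Qed.

Lemma sqrt_one_sub D a : nclosed D -> D 0 ->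
  (forall w, D w -> D ((2^-1 : R[i]) *: (a + w * w))) -> nrm a < 1 ->
  exists w, [/\ D w, nrm w <= nrm a & (1 - w) * (1 - w) = 1 - a].
Proof.
move=> Dc D0 Df a1.
have [|||||w [Dw wa] ww] := @contraction_fix (fun w => D w /\ nrm w <= nrm a)
  (fun w => (2^-1 : R[i]) *: (a + w * w)) (nrm a) 0.
- by apply: (@nclosedI D (fun w => nrm w <= nrm a) Dc); apply: nclosed_ball.
- by rewrite nrm0 nrm_ge0.
- move=> w [Dw wa]; split; first exact: Df.
  rewrite nrmZh; have := nrmD a (w * w); have := nrmM w w; have := nrm_ge0 w.
  have := nrm_ge0 a; nra.
- by rewrite nrm_ge0.
- move=> x y [_ xa] [_ ya]; rewrite -scalerBr nrmZh opprD addrACA subrr add0r.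
  have -> : x * x - y * y = x * (x - y) + (x - y) * y.
    by rewrite mulrBr mulrBl addrA subrK.
  have := nrmD (x * (x - y)) ((x - y) * y).
  have := nrmM x (x - y); have := nrmM (x - y) y; have := nrm_ge0 (x - y).
  nra.
exists w; split => //.
have {}ww : w + w = a + w * w.
  rewrite -{1 2}ww -mulr2n -(scaler_nat 2) scalerA mulfV ?scale1r //.
have -> : a = w + w - w * w by rewrite ww addrK.
ncring.
Qed.

(** The inverse of 1 - w is sought as 1 + z with z = w + w z, an equation that also bounds z. *)
Lemma neumann D w : nclosed D -> D 0 ->
  (forall z, D z -> D (w + w * z)) -> nrm w < 1 ->
  exists z, [/\ D z, nrm z * (1 - nrm w) <= nrm w & (1 - w) * (1 + z) = 1].
Proof.
move=> Dc D0 Df w1.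
have [||z Dz zz] := @contraction_fix D (fun z => w + w * z) (nrm w) 0 Dc D0 Df.
- by rewrite nrm_ge0.
- by move=> x y _ _; rewrite opprD addrACA subrr add0r -mulrBr nrmM.
exists z; split=> //.
  by have := nrmD w (w * z); rewrite zz; have := nrmM w z; lra.
by rewrite mulrBl mul1r mulrDr mulr1 zz addrK.
Qed.

End Fix.

(** * Self-adjoint elements and projections *)

Section Spectral.
Context (R : realType) (O : cstarType R).
Implicit Types (x y z a b c w h p q g : O) (D : set O).

Lemma conj_real (r : R) : (r%:C%C : R[i])^* = r%:C%C.
Proof. by apply: conj_Creal; rewrite realE -(rmorph0 (real_complex R)) !rcle -realE num_real. Qed.

Lemma star_real (r : R) x : star (r%:C%C *: x) = r%:C%C *: star x.
Proof. by rewrite starZ conj_real. Qed.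

Lemma half_real : (2^-1 : R[i]) = (2^-1 : R)%:C%C.
Proof. by rewrite fmorphV rmorph_nat. Qed.

Lemma star_half x : star ((2^-1 : R[i]) *: x) = (2^-1 : R[i]) *: star x.
Proof. by rewrite half_real star_real. Qed.

Lemma mulii : ('i : R[i]) * 'i = -1.
Proof. by rewrite -expr2 sqrCi. Qed.

(* h + i y is normal, so that its norm squared is that of h^2 + y^2. *)
Lemma nrm_sqr_le h y : star h = h -> star y = y -> h * y = y * h ->
  nrm h ^+ 2 <= nrm (h * h + y * y).
Proof.
move=> hs ys hy.
pose u := h + ('i : R[i]) *: y.
have us : star u = h - ('i : R[i]) *: y by rewrite starD starZ hs ys conjCi scaleNr.
have <- : star u * u = h * h + y * y.
  rewrite us /u mulrBl !mulrDr -!scalerAl -!scalerAr scalerA mulii scaleN1r hy.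
  by set t := _ *: _; ncring.
rewrite nrm_starx ler_pXn2r ?nnegrE ?nrm_ge0 //.
have -> : h = (2^-1 : R[i]) *: (u + star u) by rewrite (_ : u + star u = h + h) ?half2 // us /u; ncring.
rewrite nrmZh; have := nrmD u (star u); rewrite nrm_star; lra.
Qed.

Lemma nclosed_sa : nclosed (fun x : O => star x = x).
Proof. exact: nclosed_eq (lip_star (@lip_id _ _)) (@lip_id _ _). Qed.

Lemma nclosed_commute a : nclosed (fun x : O => a * x = x * a).
Proof. exact: nclosed_eq (lip_mull a (@lip_id _ _)) (lip_mulr a (@lip_id _ _)). Qed.

Lemma commute_half a x y : a * x = x * a -> a * y = y * a ->
  a * ((2^-1 : R[i]) *: (x + y)) = (2^-1 : R[i]) *: (x + y) * a.
Proof. by move=> ax ay; rewrite -scalerAr -scalerAl mulrDr mulrDl ax ay. Qed.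

Lemma sqrt_one_sub_commute a b : star a = a -> nrm a < 1 -> a * b = b * a ->
  exists y, [/\ star y = y, b * y = y * b & y * y = 1 - a].
Proof.
move=> sa a1 ab.
have [||||w [[ws wb] _ ww]] := @sqrt_one_sub _ _ (fun w => star w = w /\ b * w = w * b) a.
- exact: nclosedI nclosed_sa (@nclosed_commute b).
- by rewrite star0 mulr0 mul0r.
- move=> w [ws bw]; split; first by rewrite star_half starD starM sa ws.
  by apply: commute_half; rewrite // mulrA bw -mulrA bw mulrA.
- by [].
exists (1 - w); rewrite ww starB star1 ws mulrBr mulrBl mulr1 mul1r wb //.
Qed.

(* The unitary h + i sqrt(1 - h^2) has real part h and goes to a unitary. *)
Lemma unital_hom_contractive (f : O -> O) : linear f ->
  {morph f : x y / x * y} -> {morph f : x / star x} -> f 1 = 1 ->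
  forall x, nrm (f x) <= nrm x.
Proof.
move=> fl fM fs f1.
have f0 : f 0 = 0.
  by have := fl (-1) 0 0; rewrite !scaleN1r oppr0 addr0 => {1}->; rewrite addNr.
have fD x y : f (x + y) = f x + f y by have := fl 1 x y; rewrite !scale1r.
have fZ (c : R[i]) x : f (c *: x) = c *: f x.
  by have := fl c x 0; rewrite f0 !addr0.
have lt1 h : star h = h -> nrm h < 1 -> nrm (f h) <= 1.
  move=> hs h1.
  have [|||y [ys hy yy]] := @sqrt_one_sub_commute (h * h) h.
  - by rewrite starM hs.
  - by rewrite nrm_sa // expr_lt1 ?nrm_ge0.
  - by rewrite mulrA.
  have := @nrm_sqr_le (f h) (f y); rewrite -!fs hs ys -!fM hy -fD yy addrC subrK f1 nrm1.
  by move=> /(_ erefl erefl erefl); rewrite expr_le1 ?nrm_ge0.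
have sa h : star h = h -> nrm (f h) <= nrm h.
  move=> hs; apply/ler_addgt0Pr => d d0.
  pose c := nrm h + d; have c0 : 0 < c by rewrite ltr_wpDl ?nrm_ge0.
  have := @lt1 ((c^-1)%:C%C *: h); rewrite fZ !nrmZr ?invr_ge0 ?(ltW c0) //.
  rewrite ltr_pdivrMl // ler_pdivrMl // !mulr1; apply.
    by rewrite star_real hs.
  by rewrite ltrDl.
move=> x; rewrite -(@ler_pXn2r _ 2) ?nnegrE ?nrm_ge0 //.
by rewrite -!nrm_starx -fs -fM sa // starM starK.
Qed.

(** The element c = 1 + b^2 is the mean of (1 + b)^2 and (1 - b)^2, hence nrm c <= 1. For 0 < d < 1
    there is a self-adjoint y commuting with b such that y^2 = 1 - (1 - d) c, and then b^2 + y^2 = d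
    c bounds the square of nrm b by d. *)
Lemma pm_contractive_eq0 b : star b = b -> nrm (1 + b) <= 1 -> nrm (1 - b) <= 1 -> b = 0.
Proof.
move=> bs b1 b2; pose c := 1 + b * b.
have c1 : nrm c <= 1.
  have -> : c = (2^-1 : R[i]) *: ((1 + b) * (1 + b) + (1 - b) * (1 - b)).
    rewrite -[LHS]half2 /c; congr (_ *: _); ncring.
  rewrite nrmZh; have := nrmD ((1 + b) * (1 + b)) ((1 - b) * (1 - b)).
  have := nrmM (1 + b) (1 + b); have := nrmM (1 - b) (1 - b).
  have := nrm_ge0 (1 - b); have := nrm_ge0 (1 + b); nra.
have key (d : R) : 0 < d -> d < 1 -> nrm b ^+ 2 <= d.
  move=> d0 d1.
  have [|||y [ys by_ yy]] := @sqrt_one_sub_commute ((1 - d)%:C%C *: c) b.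
  - by rewrite star_real /c starD star1 starM bs.
  - rewrite nrmZr; last lra.
    have := nrm_ge0 c; nra.
  - by rewrite -scalerAl -scalerAr /c; congr (_ *: _); ncring.
  have := nrm_sqr_le bs ys by_; rewrite yy.
  have -> : b * b + (1 - (1 - d)%:C%C *: c) = d%:C%C *: c.
    rewrite rmorphB /= scalerBl scale1r /c.
    by set e := _ *: _; ncring.
  rewrite nrmZr; last exact: ltW.
  nra.
apply: nrm_eq0; apply/eqP; rewrite -sqrf_eq0; apply/eqP/le_anti.
rewrite exprn_ge0 ?nrm_ge0 // andbT; apply/ler_addgt0Pr => d d0; rewrite add0r.
have [d1|d1] := ltP d 1; first exact: key.
by apply: le_trans d1; apply: le_trans (key (2^-1) _ _) _; lra.
Qed.

Lemma nrm_proj p : projection p -> nrm p <= 1.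
Proof.
by move=> [ps pp]; have := nrm_sa ps; rewrite pp; have := nrm_ge0 p; nra.
Qed.

Lemma nrm_proj1 p : projection p -> p != 0 -> nrm p = 1.
Proof.
move=> [ps pp] p0; have := nrm_sa ps; rewrite pp expr2 => /eqP.
rewrite -[X in X == _]mulr1 => /eqP/mulfI <- //.
by apply: contra_neq p0; apply: nrm_eq0.
Qed.

Lemma projectionC p : projection p -> projection (1 - p).
Proof.
move=> [ps pp]; split; first by rewrite starB star1 ps.
by rewrite mulrBl mul1r mulrBr mulr1 pp subrr subr0.
Qed.

Lemma expr2X_bound (t : R) : 0 <= t -> (forall k, t ^+ (2 ^ k) <= 2) -> t <= 1.
Proof.
move=> t0 tk; rewrite leNgt; apply/negP => t1.
have ti : `|t^-1| < 1 by rewrite ger0_norm ?invr_ge0 // invf_lt1 // (lt_trans ltr01).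
have tii : 0 <= t^-1 < 1 by rewrite -[X in X < 1]ger0_norm ?ti invr_ge0 t0.
have [N /(_ (2 ^ N)%N)] := geometric_small 2 tii (ltr01 : (0 : R) < 1).
have NN : (N <= 2 ^ N)%N by exact: ltnW (ltn_expl N (ltnSn 1)).
move=> /(_ NN).
rewrite exprVn ltr_pdivrMr ?mul1r; first by have := tk N; lra.
by rewrite exprn_gt0 // (lt_trans ltr01).
Qed.

(* The powers 1 - p + g^(2^k) are bounded by 2. *)
Lemma nrm_compl_add p g : projection p -> star g = g -> p * g = g -> nrm g <= 1 ->
  nrm (1 - p + g) <= 1.
Proof.
move=> pp gs pg g1; have [ps _] := pp.
have gp : g * p = g by rewrite -{1}gs -{1}ps -starM pg.
apply: expr2X_bound (nrm_ge0 _) _ => k.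
elim: k g gs pg gp g1 => [|k IH] g gs pg gp g1.
  rewrite expr1; have := nrmD (1 - p) g; have := nrm_proj (projectionC pp); lra.
have hs : star (1 - p + g) = 1 - p + g by rewrite starD starB star1 ps gs.
rewrite expnS exprM -nrm_sa //.
have -> : (1 - p + g) * (1 - p + g) = 1 - p + g * g.
  have [_ ppp] := pp.
  transitivity (1 - p - p + p * p + g - p * g + g - g * p + g * g); first ncring.
  by rewrite ppp pg gp; ncring.
apply: IH; rewrite ?starM ?gs ?mulrA ?pg // -?mulrA ?gp //.
by have := nrmM g g; have := nrm_ge0 g; nra.
Qed.

Lemma nrm_one_sub_compress p q : projection p -> projection q -> nrm (1 - p * q * p) <= 1.
Proof.
move=> pp qq; have [ps ppp] := pp; have [qs _] := projectionC qq.
have -> : 1 - p * q * p = 1 - p + p * (1 - q) * p.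
  by rewrite mulrBr mulr1 mulrBl ppp; ncring.
apply: nrm_compl_add => //.
- by rewrite !starM ps qs mulrA.
- by rewrite !mulrA ppp.
have := nrmM (p * (1 - q)) p; have := nrmM p (1 - q).
have := nrm_proj pp; have := nrm_proj (projectionC qq).
have := nrm_ge0 p; have := nrm_ge0 (1 - q); have := nrm_ge0 (p * (1 - q)); nra.
Qed.

(** The elements a_l = e_j e_l e_j with l != j sum to 0, and nrm (1 - a_l) <= 1 stands for their
    positivity. Solving for a_i and adding up the bounds, both (m + 1) + a_i and (m + 1) - a_i have
    norm at most m + 1, where m counts the indices other than i and j. Hence a_i = 0, and a_i is x^*
    x for x = e_i e_j. *)
Lemma projections_orthogonal k (e : 'I_k -> O) : (forall j, projection (e j)) ->
  \sum_(j < k) e j = 1 -> forall i j, i != j -> e i * e j = 0.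
Proof.
move=> ep e1 i j ij.
pose a l := e j * e l * e j.
have aS : \sum_(l | l != j) a l = 0.
  have : \sum_l a l = e j.
    by rewrite -mulr_suml -mulr_sumr e1 mulr1; case: (ep j).
  rewrite (bigD1 j) //= /a; case: (ep j) => _ jj; rewrite !jj.
  by move/eqP; rewrite -subr_eq0 addrAC subrr add0r => /eqP.
have as_ l : star (a l) = a l.
  by rewrite /a !starM; case: (ep j) => -> _; case: (ep l) => -> _; rewrite mulrA.
have a1 l : nrm (1 - a l) <= 1 by apply: nrm_one_sub_compress.
pose P := [pred l : 'I_k | (l != j) && (l != i)].
pose m := #|P|.
have ai : a i = - \sum_(l in P) a l.
  apply/eqP; rewrite -addr_eq0; move: aS; rewrite (bigD1 i) //= => /eqP.
  by congr (_ + _ == 0); apply: eq_bigl.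
have m1 : nrm (1 *+ m.+1 + a i) <= m.+1%:R.
  rewrite ai.
  have -> : (1 : O) *+ m.+1 - \sum_(l in P) a l = 1 + \sum_(l in P) (1 - a l).
    by rewrite sumrB sumr_const mulrS addrA.
  apply: le_trans (nrmD _ _) _; rewrite nrm1 -natr1 addrC lerD2r.
  have -> : m%:R = \sum_(l in P) (1 : R) by rewrite sumr_const.
  elim/big_rec2 : _ => [|l u v _ uv]; first by rewrite nrm0.
  by apply: le_trans (nrmD _ _) _; rewrite lerD.
have m2 : nrm (1 *+ m.+1 - a i) <= m.+1%:R.
  rewrite mulrS -addrAC; apply: le_trans (nrmD _ _) _; rewrite -natr1 [X in _ <= X]addrC lerD //.
  have -> : (1 : O) *+ m = (m%:R : R)%:C%C *: 1 by rewrite rmorph_nat scaler_nat.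
  by rewrite nrmZr ?ler0n // nrm1 mulr1.
have mp : 0 < (m.+1%:R : R) by rewrite ltr0n.
pose t := ((m.+1%:R : R)^-1)%:C%C.
have t1 : t *: ((1 : O) *+ m.+1) = 1.
  by rewrite -scaler_nat scalerA /t fmorphV rmorph_nat mulVf ?scale1r ?pnatr_eq0.
have nt z : nrm z <= m.+1%:R -> nrm (t *: z) <= 1.
  by move=> zm; rewrite /t nrmZr ?invr_ge0 ?(ltW mp) // ler_pdivrMl // mulr1.
have : t *: a i = 0.
  apply: pm_contractive_eq0; first by rewrite star_real as_.
    by rewrite -{1}t1 -scalerDr nt.
  by rewrite -{1}t1 -scalerBr nt.
move/eqP; rewrite scaler_eq0 => /orP[|/eqP ai0].
  by rewrite fmorph_eq0 invr_eq0 pnatr_eq0.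
apply: nrm_eq0; apply/eqP; rewrite -sqrf_eq0 -nrm_starx starM.
case: (ep i) => -> ii; case: (ep j) => -> _.
by rewrite -mulrA (mulrA (e i)) ii mulrA -/(a i) ai0 nrm0.
Qed.

End Spectral.

(** * Words in the Cuntz generators *)

Section Cuntz.
Context (R : realType) (n : nat) (O : cstarType R) (S : 'I_n -> O).
Context (n_ge2 : (2 <= n)%N) (O_cuntz : is_cuntz S).
Implicit Types (x y z a b c w h p q g : O) (D : set O) (v t : seq 'I_n).

Definition i0 : 'I_n := Ordinal (ltnW n_ge2).
Definition i1 : 'I_n := Ordinal n_ge2.

Lemma S_iso i : star (S i) * S i = 1.
Proof. exact: cuntz_isometry. Qed.

(** The range projections S_i S_i^* sum to 1, so they are orthogonal. *)
Lemma S_orth i j : i != j -> star (S i) * S j = 0.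
Proof.
move=> ij; have Sp l : projection (S l * star (S l)).
  split; first by rewrite starM starK.
  by rewrite -mulrA (mulrA (star (S l))) S_iso mul1r.
have := projections_orthogonal Sp (cuntz_sum O_cuntz) ij.
move/(congr1 (fun x => star (S i) * x * S j)); rewrite mulr0 mul0r => <-.
by rewrite !mulrA S_iso mul1r -(mulrA _ (star (S j))) S_iso mulr1.
Qed.

Definition word v : O := foldr (fun i x => S i * x) 1 v.

Lemma word_cat v t : word (v ++ t) = word v * word t.
Proof. by elim: v => [|i v IH] /=; rewrite ?mul1r // IH mulrA. Qed.

Lemma word_nseq m i : word (nseq m i) = S i ^+ m.
Proof. by elim: m => [|m IH] //=; rewrite IH exprS. Qed.

Lemma word_iso v : star (word v) * word v = 1.
Proof.
elim: v => [|i v IH] /=; first by rewrite star1 mulr1.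
by rewrite starM -mulrA (mulrA (star (S i))) S_iso mul1r IH.
Qed.

Lemma pow_iso m i : star (S i ^+ m) * S i ^+ m = 1.
Proof. by rewrite -word_nseq word_iso. Qed.

(** A common prefix cancels; the three cases are v a prefix of t, t a prefix of v, and a first
    disagreement. *)
Lemma word_compress v t :
  [\/ exists s, star (word v) * word t = word s,
      exists s, star (word v) * word t = star (word s) |
      star (word v) * word t = 0].
Proof.
elim: v t => [|i v IH] [|j t] /=.
- by constructor 1; exists [::]; rewrite star1 mulr1.
- by constructor 1; exists (j :: t); rewrite star1 mul1r.
- by constructor 2; exists (i :: v); rewrite mulr1.
rewrite starM -mulrA (mulrA (star (S i))).
have [<-|ij] := eqVneq i j; first by rewrite S_iso mul1r.
by rewrite S_orth // mul0r mulr0; constructor 3.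
Qed.

Definition mono v t : O := word v * star (word t).

(* The dense *-subalgebra generated by the S_i. *)
Inductive wpoly : O -> Prop :=
  | wpoly_mono (c : R[i]) v t : wpoly (c *: mono v t)
  | wpoly_add x y : wpoly x -> wpoly y -> wpoly (x + y).

Lemma wpoly0 : wpoly 0.
Proof. by have := wpoly_mono 0 [::] [::]; rewrite scale0r. Qed.

Lemma wpoly_scale (c : R[i]) x : wpoly x -> wpoly (c *: x).
Proof.
elim=> [d v t|y z _ IHy _ IHz]; first by rewrite scalerA; constructor.
by rewrite scalerDr; constructor.
Qed.

Lemma wpoly_star x : wpoly x -> wpoly (star x).
Proof.
elim=> [d v t|y z _ IHy _ IHz]; last by rewrite starD; constructor.
by rewrite starZ starM starK; constructor.
Qed.

Lemma wpoly_mono_mul v t v' t' : wpoly (mono v t * mono v' t').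
Proof.
rewrite /mono -mulrA (mulrA (star (word t))).
have [[s ->]|[s ->]|->] := word_compress t v'.
- by rewrite mulrA -word_cat; have := wpoly_mono 1 (v ++ s) t'; rewrite scale1r.
- by rewrite -starM -word_cat; have := wpoly_mono 1 v (t' ++ s); rewrite scale1r.
- by rewrite mul0r mulr0; apply: wpoly0.
Qed.

Lemma wpoly_mul x y : wpoly x -> wpoly y -> wpoly (x * y).
Proof.
elim=> [c v t|x1 x2 _ IH1 _ IH2] py; last by rewrite mulrDl; constructor; auto.
elim: py => [c' v' t'|y1 y2 _ IH1 _ IH2]; last by rewrite mulrDr; constructor.
by rewrite -scalerAl -scalerAr; do 2!apply: wpoly_scale; apply: wpoly_mono_mul.
Qed.

Lemma word_approx x (d : R) : 0 < d -> exists2 y, wpoly y & nrm (x - y) < d.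
Proof.
pose D : set O := fun x => forall d : R, 0 < d -> exists2 y, wpoly y & nrm (x - y) < d.
have pD y : wpoly y -> D y by move=> py e e0; exists y; rewrite // subrr nrm0.
have Dc : nclosed D.
  move=> y yP e e0; have e2 : 0 < e / 2 by lra.
  have [z Dz yz] := yP _ e2; have [a pa za] := Dz _ e2.
  by exists a => //; have := nrm_tri z y a; lra.
(* Closed conditions extend from polynomials to their limits. Sums and products are treated one
   argument at a time, since [lip] concerns maps of one variable. *)
have D_ind (D' : set O) : nclosed D' -> (forall y, wpoly y -> D' y) -> forall y, D y -> D' y.
  move=> D'c pD' y Dy; apply: D'c => e e0; have [z pz yz] := Dy _ e0.
  by exists z; auto.
suff DT : D = setT by (have : D x by rewrite DT); apply.
apply: (cuntz_generates O_cuntz).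
  split.
  - exact/nclosedP.
  - exact/pD/wpoly0.
  - move=> c; have Dadd y z : D y -> wpoly z -> D (c *: y + z).
      move=> Dy pz; move: y Dy; apply: (D_ind (fun y => D (c *: y + z))).
        apply: nclosed_preim => //; apply: lip_add; last exact: lip_cst.
        exact/lip_scale/lip_id.
      by move=> y py; apply: pD; constructor => //; apply: wpoly_scale.
    move=> y z Dy; move: z; apply: (D_ind (fun z => D (c *: y + z))).
      by apply: nclosed_preim => //; apply: lip_add; [exact: lip_cst|exact: lip_id].
    by move=> z; apply: Dadd.
  - have Dmul y z : D y -> wpoly z -> D (y * z).
      move=> Dy pz; move: y Dy; apply: (D_ind (fun y => D (y * z))).
        by apply: nclosed_preim => //; apply/lip_mulr/lip_id.
      by move=> y py; apply: pD; apply: wpoly_mul.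
    move=> y z Dy; move: z; apply: (D_ind (fun z => D (y * z))).
      by apply: nclosed_preim => //; apply/lip_mull/lip_id.
    by move=> z; apply: Dmul.
  - apply: (D_ind (fun z => D (star z))).
      by apply: nclosed_preim => //; apply/lip_star/lip_id.
    by move=> y py; apply/pD/wpoly_star.
move=> i; apply: pD; have := wpoly_mono 1 [:: i] [::].
by rewrite scale1r /mono /= star1 !mulr1.
Qed.

(** * Elements that commute with F *)

Definition scal x := exists c : R[i], x = c%:A.

Lemma scal0 : scal 0. Proof. by exists 0; rewrite scale0r. Qed.
Lemma scal1 : scal 1. Proof. by exists 1; rewrite scale1r. Qed.
Lemma scalD x y : scal x -> scal y -> scal (x + y).
Proof. by move=> [c ->] [d ->]; exists (c + d); rewrite scalerDl. Qed.
Lemma scalZ (c : R[i]) x : scal x -> scal (c *: x).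
Proof. by move=> [d ->]; exists (c * d); rewrite scalerA. Qed.
Lemma scalM x y : scal x -> scal y -> scal (x * y).
Proof. by move=> [c ->] [d ->]; exists (c * d); rewrite -scalerAl mul1r scalerA. Qed.
Lemma scal_star x : scal x -> scal (star x).
Proof. by move=> [c ->]; exists (c^*); rewrite starZ star1. Qed.

(** The canonical endomorphism of O_n. *)
Definition Psi x : O := \sum_i S i * x * star (S i).

Lemma Psi_contractive x : nrm (Psi x) <= nrm x.
Proof.
apply: unital_hom_contractive => [c y z|y z|y|]; rewrite /Psi.
- rewrite scaler_sumr -big_split /=; apply: eq_bigr => i _.
  by rewrite mulrDr mulrDl -scalerAr -scalerAl.
- rewrite mulr_suml; apply: eq_bigr => i _; rewrite mulr_sumr (bigD1 i) //=.
  rewrite big1 ?addr0 => [|j ji].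
    by rewrite -!mulrA (mulrA (star (S i))) S_iso mul1r.
  by rewrite -!mulrA (mulrA (star (S i))) S_orth 1?eq_sym // mul0r !mulr0.
- by rewrite star_sum; apply: eq_bigr => i _; rewrite !starM starK mulrA.
- by rewrite -[RHS](cuntz_sum O_cuntz); apply: eq_bigr => i _; rewrite mulr1.
Qed.

Lemma Psi_scal (c : R[i]) : Psi c%:A = c%:A.
Proof.
rewrite /Psi -[in RHS](cuntz_sum O_cuntz) scaler_sumr; apply: eq_bigr => i _.
by rewrite -scalerAr mulr1 -scalerAl.
Qed.

Lemma PsiB x y : Psi (x - y) = Psi x - Psi y.
Proof. by rewrite /Psi -sumrB; apply: eq_bigr => i _; rewrite mulrBr mulrBl. Qed.

(** These monomials span a dense subspace of F, so this describes the relative commutant of F in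
    O_n. *)
Definition gauge_commuting c := forall v t, size v = size t -> c * mono v t = mono v t * c.

Lemma gauge_commuting_compress c i : gauge_commuting c -> gauge_commuting (star (S i) * c * S i).
Proof.
move=> cc v t vt.
have h : S i * mono v t = mono (i :: v) (i :: t) * S i.
  by rewrite /mono /= starM -!mulrA S_iso mulr1.
have h' : mono v t * star (S i) = star (S i) * mono (i :: v) (i :: t).
  by rewrite /mono /= starM !mulrA S_iso mul1r.
have cM : c * mono (i :: v) (i :: t) = mono (i :: v) (i :: t) * c.
  by apply: cc; rewrite /= vt.
move: (mono (i :: v) (i :: t)) h h' cM => M h h' cM.
by rewrite -!mulrA h !mulrA h' -!mulrA (mulrA c) cM -mulrA.
Qed.

(** Moving c past S_i S_j^* turns the summand S_j S_i^* c S_i S_j^* into S_j S_j^* c, so [Psi]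
    undoes the compression by any generator. *)
Lemma gauge_commuting_Psi c i : gauge_commuting c -> Psi (star (S i) * c * S i) = c.
Proof.
move=> cc; rewrite /Psi -[RHS]mul1r -(cuntz_sum O_cuntz) mulr_suml.
apply: eq_bigr => j _.
have := cc [:: i] [:: j] erefl; rewrite /mono /= !mulr1 => h.
by rewrite -!mulrA h !mulrA -(mulrA (S j)) S_iso mulr1.
Qed.

Lemma gauge_commuting_iter c v : gauge_commuting c ->
  iter (size v) Psi (star (word v) * c * word v) = c.
Proof.
elim: v c => [|i v IH] c cc /=; first by rewrite star1 mul1r mulr1.
rewrite starM -!mulrA (mulrA (star (S i))) (mulrA _ _ (word v)) (mulrA (star (word v))).
by rewrite IH ?gauge_commuting_Psi //; apply: gauge_commuting_compress.
Qed.

(* The word 1^m 2, with 1 and 2 standing for i0 and i1. *)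
Definition aper m : O := S i0 ^+ m * S i1.

Lemma i01 : i0 != i1. Proof. by []. Qed.

(** The first m letters of 1^m 2 are all 1: either v consists of 1s and cancels, or it disagrees
    with the word somewhere. *)
Lemma aper_word m v : (size v <= m)%N ->
  star (aper m) * word v = 0 \/ star (aper m) * word v = star (aper (m - size v)).
Proof.
elim: v m => [|i v IH] [|m] //= vm; rewrite ?mulr1 ?subn0; try by right.
rewrite subSS /aper exprS -mulrA starM -mulrA (mulrA (star (S i0))).
have [<-|ij] := eqVneq i0 i; first by rewrite S_iso mul1r; apply: IH.
by left; rewrite S_orth // mul0r mulr0.
Qed.

(** For m != k neither of 1^m 2 and 1^k 2 is a prefix of the other, so the product is 1 or 0. *)
Lemma aper_aper m k : scal (star (aper m) * aper k).
Proof.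
have i10 : i1 != i0 by [].
elim: m k => [|m IH] [|k]; rewrite /aper ?expr0 ?mul1r.
- by rewrite S_iso; apply: scal1.
- by rewrite exprS -mulrA mulrA S_orth // mul0r; apply: scal0.
- by rewrite exprS starM starM -!mulrA S_orth ?i01 // !mulr0; apply: scal0.
- rewrite !exprS -!mulrA starM -!mulrA (mulrA (star (S i0)) (S i0)) S_iso mul1r.
  exact: IH.
Qed.

Lemma aper_poly y : wpoly y ->
  exists N, forall m, (N <= m)%N -> scal (star (aper m) * y * aper m).
Proof.
elim=> [c v t|x1 x2 _ [N1 H1] _ [N2 H2]].
  exists (maxn (size v) (size t)) => m; rewrite geq_max => /andP[vm tm].
  rewrite -scalerAr -scalerAl; apply: scalZ; rewrite /mono (mulrA (star (aper m))) -(mulrA _ (star (word t))).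
  rewrite -[star (word t) * _]starK starM starK.
  have [->|->] := aper_word vm; first by rewrite mul0r; apply: scal0.
  have [->|->] := aper_word tm; first by rewrite star0 mulr0; apply: scal0.
  by rewrite starK; apply: aper_aper.
exists (maxn N1 N2) => m; rewrite geq_max => /andP[/H1 h1 /H2 h2].
by rewrite mulrDr mulrDl; apply: scalD.
Qed.

Lemma aperE m : aper m = word (nseq m i0 ++ [:: i1]).
Proof. by rewrite word_cat word_nseq /= mulr1. Qed.

Lemma isoK a x : star a * a = 1 -> star a * (a * x) = x.
Proof. by rewrite mulrA => ->; rewrite mul1r. Qed.

Lemma nrm_iso a : star a * a = 1 -> nrm a = 1.
Proof. by move=> aa; have := nrm_starx a; rewrite aa nrm1; have := nrm_ge0 a; nra. Qed.

Lemma nrm_compress_iso a x : star a * a = 1 -> nrm (star a * x * a) <= nrm x.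
Proof.
move=> /nrm_iso a1; have := nrmM (star a * x) a; have := nrmM (star a) x.
by rewrite nrm_star a1 mulr1 mul1r; lra.
Qed.

Lemma nrm_sandwich_iso a x : star a * a = 1 -> nrm (a * x * star a) <= nrm x.
Proof.
move=> /nrm_iso a1; have := nrmM (a * x) (star a); have := nrmM a x.
by rewrite nrm_star a1 mulr1 mul1r; lra.
Qed.

(* The corner of a polynomial at the aperiodic word 1^m 2 is a scalar for large
   m, whereas an element commuting with the gauge-invariant monomials is
   recovered from any of its corners by iterating Psi. *)
Lemma gauge_commuting_scal c (d : R) : gauge_commuting c -> 0 < d ->
  exists2 y, scal y & nrm (c - y) < d.
Proof.
move=> cc /(word_approx c)[y py cy].
have [N /(_ N (leqnn N))[l lE]] := aper_poly py.
exists l%:A; first by exists l.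
apply: le_lt_trans cy.
have iterB m x z : iter m Psi (x - z) = iter m Psi x - iter m Psi z.
  by elim: m => //= m ->; rewrite PsiB.
have iterS m : iter m Psi l%:A = l%:A by elim: m => //= m ->; rewrite Psi_scal.
have itern m x : nrm (iter m Psi x) <= nrm x.
  by elim: m => //= m; apply: le_trans (Psi_contractive _).
set v := nseq N i0 ++ [:: i1].
rewrite -{1}(gauge_commuting_iter v cc) -(iterS (size v)) -iterB.
apply: le_trans (itern _ _) _; rewrite -lE aperE -/v -mulrBl -mulrBr.
exact/nrm_compress_iso/word_iso.
Qed.

End Cuntz.

(** * The gauge action and its fixed-point algebra *)

Section DyadicRoots.
Context (C : numClosedFieldType).
Implicit Type w : nat -> C.

(* A coherent choice of primitive 2^s-th roots of unity. *)
Fixpoint zeta (s : nat) : C :=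
  match s with 0 => 1 | s'.+1 => if s' is _.+1 then sqrtC (zeta s') else -1 end.

Lemma zeta_sqr s : zeta s.+1 ^+ 2 = zeta s.
Proof. by case: s => [|s] /=; rewrite ?sqrrN ?expr1n // sqrtCK. Qed.

Lemma norm_zeta s : `|zeta s| = 1.
Proof.
elim: s => [|s IH]; first by rewrite normr1.
by apply/eqP; rewrite -(@eqrXn2 _ 2) // -normrX zeta_sqr IH expr1n.
Qed.

(** At s = 1 the root is -1, so d is even; passing from s to s + 1 then replaces d by d / 2, and the
    descent ends at 0. *)
Lemma zeta_torsion_free d : (forall s, zeta s ^+ d = 1) -> d = 0%N.
Proof.
have [m] := ubnP d; elim: m d => // m IH d dm dz.
have [d0|d0] := eqVneq d 0%N => //.
have od : ~~ odd d.
  apply/negP => od; have := dz 1%N; rewrite /= -signr_odd od expr1 => /eqP.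
  by rewrite eqNr oner_eq0.
have de : d = (d./2).*2 by rewrite -[LHS]odd_double_half (negbTE od).
have : d./2 = 0%N.
  apply: IH => [|s].
    by rewrite ltnS in dm; apply: leq_trans dm; rewrite {2}de -addnn -{1}(addn0 d./2) ltn_add2l lt0n; apply: contra_neq d0 => h; rewrite de h.
  by move: (dz s.+1); rewrite {1}de -muln2 mulnC exprM zeta_sqr.
by move=> h; rewrite de h.
Qed.

(** The square roots of 1 are 1 and -1, so the sequence can leave 1 only through -1. *)
Lemma dyadic_dichotomy w : w 0%N = 1 -> (forall s, w s.+1 ^+ 2 = w s) ->
  (forall s, w s = 1) \/ exists s, w s.+1 = -1.
Proof.
move=> w0 ws; have [h|h] := pselect (exists s, w s.+1 = -1); first by right.
left; elim=> // s IH; have /eqP := ws s; rewrite IH sqrf_eq1 => /orP[/eqP//|/eqP e].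
by case: h; exists s.
Qed.

End DyadicRoots.

Section Gauge.
Context (R : realType) (n : nat) (O : cstarType R) (S : 'I_n -> O)
  (gamma : R[i] -> O -> O).
Context (O_cuntz : is_cuntz S) (gammaP : gauge_action S gamma).
Implicit Types (x y z a b c w h p q g : O) (D : set O) (v t : seq 'I_n).

Local Notation F := (fixed_algebra gamma).
Local Notation word := (word S).
Local Notation mono := (mono S).
Local Notation zeta := (@zeta R[i]).

Section UnitCircle.
Context (z : R[i]) (z1 : `|z| = 1).

Lemma gam_lin : linear (gamma z). Proof. by case: (gauge_aut gammaP z1). Qed.
Lemma gamM : {morph gamma z : x y / x * y}. Proof. by case: (gauge_aut gammaP z1). Qed.
Lemma gam_star : {morph gamma z : x / star x}. Proof. by case: (gauge_aut gammaP z1). Qed.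
Lemma gam0 : gamma z 0 = 0.
Proof.
by have := gam_lin (-1) 0 0; rewrite !scaleN1r oppr0 addr0 => {1}->; rewrite addNr.
Qed.
Lemma gamD x y : gamma z (x + y) = gamma z x + gamma z y.
Proof. by have := gam_lin 1 x y; rewrite !scale1r. Qed.
Lemma gamZ (c : R[i]) x : gamma z (c *: x) = c *: gamma z x.
Proof. by have := gam_lin c x 0; rewrite gam0 !addr0. Qed.
Lemma gamN x : gamma z (- x) = - gamma z x.
Proof. by rewrite -scaleN1r gamZ scaleN1r. Qed.
Lemma gam1 : gamma z 1 = 1.
Proof.
have [_ _ _ [f _ fK]] := gauge_aut gammaP z1.
by rewrite -[LHS]mulr1 -[X in _ * X]fK -gamM mul1r fK.
Qed.

Lemma gam_contractive x : nrm (gamma z x) <= nrm x.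
Proof.
exact: unital_hom_contractive gam_lin gamM gam_star gam1 x.
Qed.

Lemma gam_word v : gamma z (word v) = z ^+ size v *: word v.
Proof.
elim: v => [|i v IH] /=; first by rewrite gam1 scale1r.
by rewrite gamM IH (gauge_gen gammaP) // -scalerAl -scalerAr scalerA exprS.
Qed.

Lemma gam_mono v t :
  gamma z (mono v t) = (z ^+ size v * (z ^+ size t)^*) *: mono v t.
Proof.
rewrite /mono gamM gam_star !gam_word starZ -scalerAl -scalerAr scalerA //.
Qed.

Lemma unit_conj m : z ^+ m * (z ^+ m)^* = 1.
Proof. by rewrite -normCK normrX z1 !expr1n. Qed.

End UnitCircle.

Lemma F0 : F 0. Proof. by move=> z z1; rewrite gam0. Qed.
Lemma F1 : F 1. Proof. by move=> z z1; rewrite gam1. Qed.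
Lemma FD x y : F x -> F y -> F (x + y).
Proof. by move=> Fx Fy z z1; rewrite gamD // Fx // Fy. Qed.
Lemma FN x : F x -> F (- x).
Proof. by move=> Fx z z1; rewrite gamN // Fx. Qed.
Lemma FB x y : F x -> F y -> F (x - y).
Proof. by move=> Fx /FN; apply: FD. Qed.
Lemma FZ (c : R[i]) x : F x -> F (c *: x).
Proof. by move=> Fx z z1; rewrite gamZ // Fx. Qed.
Lemma FM x y : F x -> F y -> F (x * y).
Proof. by move=> Fx Fy z z1; rewrite gamM // Fx // Fy. Qed.
Lemma F_star x : F x -> F (star x).
Proof. by move=> Fx z z1; rewrite gam_star // Fx. Qed.
Lemma F_sum (I : Type) (r : seq I) (P : pred I) (f : I -> O) :
  (forall i, P i -> F (f i)) -> F (\sum_(i <- r | P i) f i).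
Proof. by move=> Ff; elim/big_ind: _ => //; [exact: F0 | exact: FD]. Qed.
Lemma F_scal x : scal x -> F x.
Proof. by case=> c ->; apply/FZ/F1. Qed.

Lemma F_nclosed : nclosed F.
Proof.
move=> x xP z z1.
have gl : lip (gamma z).
  by exists 1 => a b; rewrite mul1r -gamN // -gamD // gam_contractive.
apply: (nclosed_eq gl (@lip_id _ _)) => d /xP[y Fy xy].
by exists y => //; apply: Fy.
Qed.

Lemma F_mono v t : size v = size t -> F (mono v t).
Proof. by move=> vt z z1; rewrite gam_mono // vt unit_conj // scale1r. Qed.

Lemma F_sandwich i j x : F x -> F (S i * x * star (S j)).
Proof.
move=> Fx z z1.
rewrite !gamM // gam_star // Fx // !(gauge_gen gammaP) // starZ.
by rewrite -scalerAr -!scalerAl scalerA mulrC -[z]expr1 unit_conj // scale1r.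
Qed.

Lemma F_pow_sandwich i m x : F x -> F (S i ^+ m * x * star (S i ^+ m)).
Proof.
elim: m => [|m IH] Fx; first by rewrite expr0 mul1r star1 mulr1.
by rewrite exprS starM !mulrA -(mulrA (S i)) -(mulrA (S i)); apply/F_sandwich/IH.
Qed.

Lemma F_pow_compress i m x : F x -> F (star (S i ^+ m) * x * S i ^+ m).
Proof.
move=> Fx z z1; rewrite -word_nseq !gamM // gam_star // Fx // !gam_word // starZ.
by rewrite -scalerAr -!scalerAl scalerA unit_conj // scale1r.
Qed.

(* The average of gamma over the 2^K-th roots of unity: a substitute for the
   conditional expectation onto F that needs no integration. *)
Fixpoint avg K x : O :=
  if K is K'.+1 then (2^-1 : R[i]) *: (avg K' x + gamma (zeta K) (avg K' x)) else x.

Lemma avgD K x y : avg K (x + y) = avg K x + avg K y.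
Proof.
elim: K => //= K ->; rewrite gamD; last exact: (@norm_zeta R[i] K.+1).
by rewrite addrACA scalerDr.
Qed.

Lemma avgZ K (c : R[i]) x : avg K (c *: x) = c *: avg K x.
Proof.
elim: K => //= K ->; rewrite gamZ; last exact: (@norm_zeta R[i] K.+1).
by rewrite -scalerDr !scalerA mulrC.
Qed.

Lemma avgB K x y : avg K (x - y) = avg K x - avg K y.
Proof. by rewrite avgD -scaleN1r avgZ scaleN1r. Qed.

Lemma avg_contractive K x : nrm (avg K x) <= nrm x.
Proof.
elim: K => //= K IH; rewrite nrmZh.
have := nrmD (avg K x) (gamma (zeta K.+1) (avg K x)).
have := @gam_contractive (zeta K.+1) (norm_zeta _ _) (avg K x); rewrite /=; lra.
Qed.

Lemma avg_fixed K x : (forall s, gamma (zeta s) x = x) -> avg K x = x.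
Proof. by move=> xf; elim: K => //= K ->; have /= -> := xf K.+1; rewrite half2. Qed.

(** Before the stage with eigenvalue -1 the average is a multiple of a; that stage adds it to its
    opposite, and from there on all averages vanish. *)
Lemma avg_eigen (w : nat -> R[i]) a : w 0%N = 1 -> (forall s, w s.+1 ^+ 2 = w s) ->
  (forall s, gamma (zeta s) a = w s *: a) ->
  (forall s, w s = 1) \/ exists K0, forall K, (K0 <= K)%N -> avg K a = 0.
Proof.
move=> w0 ws aw; have [?|[s s1]] := dyadic_dichotomy w0 ws; [by left|right].
have [c cE] : exists c : R[i], avg s a = c *: a.
  elim: {s1}s => [|s [c cE]]; first by exists 1; rewrite scale1r.
  exists (2^-1 * (c + c * w s.+1)); rewrite [avg _ _]/= cE gamZ; last exact: (@norm_zeta R[i] s.+1).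
  by have /= -> := aw s.+1; rewrite scalerA -scalerDl scalerA.
exists s.+1; elim=> // K IH; rewrite leq_eqVlt => /orP[/eqP[<-]|/IH {IH}aK].
  rewrite [avg _ _]/= cE gamZ; last exact: (@norm_zeta R[i] s.+1).
  by have /= -> := aw s.+1; rewrite s1 scaleN1r scalerN subrr scaler0.
by rewrite [avg _ _]/= aK gam0 ?addr0 ?scaler0 //; exact: (@norm_zeta R[i] K.+1).
Qed.

(* The matrix algebra spanned by the S_v S_w^* with |v| = |w| = r. *)
Fixpoint Fr r x : Prop :=
  if r is r'.+1 then forall i j, Fr r' (star (S i) * x * S j) else scal x.

Lemma FrD r x y : Fr r x -> Fr r y -> Fr r (x + y).
Proof.
elim: r x y => [|r IH] x y /= xr yr; first exact: scalD.
by move=> i j; rewrite mulrDr mulrDl; apply: IH.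
Qed.

Lemma FrZ r (c : R[i]) x : Fr r x -> Fr r (c *: x).
Proof.
elim: r x => [|r IH] x /= xr; first exact: scalZ.
by move=> i j; rewrite -scalerAr -scalerAl; apply: IH.
Qed.

Lemma Fr0 r : Fr r 0.
Proof. by elim: r => [|r IH] /=; [exact: scal0|move=> i j; rewrite mulr0 mul0r]. Qed.

Lemma FrN r x : Fr r x -> Fr r (- x).
Proof. by rewrite -scaleN1r; apply: FrZ. Qed.

Lemma FrB r x y : Fr r x -> Fr r y -> Fr r (x - y).
Proof. by move=> xr /FrN; apply: FrD. Qed.

Lemma Fr_sum r (I : Type) (s : seq I) (P : pred I) (f : I -> O) :
  (forall i, P i -> Fr r (f i)) -> Fr r (\sum_(i <- s | P i) f i).
Proof. by move=> Ff; elim/big_ind: _ => //; [exact: Fr0 | exact: FrD]. Qed.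

Lemma FrM r x y : Fr r x -> Fr r y -> Fr r (x * y).
Proof.
elim: r x y => [|r IH] x y /= xr yr; first exact: scalM.
move=> i j; have -> : star (S i) * (x * y) * S j =
    \sum_l (star (S i) * x * S l) * (star (S l) * y * S j).
  rewrite -[X in X * y]mulr1 -(cuntz_sum O_cuntz) mulr_sumr mulr_suml mulr_sumr mulr_suml.
  by apply: eq_bigr => l _; rewrite !mulrA.
by apply: Fr_sum => l _; apply: IH.
Qed.

Lemma Fr_star r x : Fr r x -> Fr r (star x).
Proof.
elim: r x => [|r IH] x /= xr; first exact: scal_star.
by move=> i j; have := IH _ (xr j i); rewrite !starM starK mulrA.
Qed.

Lemma Fr_succ r x : Fr r x -> Fr r.+1 x.
Proof.
elim: r x => [|r IH] x xr; last by move=> i j; apply: IH; apply: xr.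
move=> i j; case: xr => c ->; rewrite /= -scalerAr mulr1 -scalerAl; apply: scalZ.
have [->|ij] := eqVneq i j; first by rewrite (S_iso O_cuntz); apply: scal1.
by rewrite (S_orth O_cuntz) //; apply: scal0.
Qed.

Lemma Fr_le r s x : (r <= s)%N -> Fr r x -> Fr s x.
Proof.
by move=> /subnK <- xr; elim: (s - r)%N => // m; rewrite addSn; apply: Fr_succ.
Qed.

Lemma Fr1 r : Fr r 1.
Proof. by apply: (@Fr_le 0) => //; apply: scal1. Qed.

Lemma S_decomp x : x = \sum_i \sum_j S i * (star (S i) * x * S j) * star (S j).
Proof.
rewrite -[LHS]mul1r -[X in X * x](cuntz_sum O_cuntz) mulr_suml.
apply: eq_bigr => i _; rewrite -[LHS]mulr1 -(cuntz_sum O_cuntz) mulr_sumr.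
by apply: eq_bigr => j _; rewrite !mulrA.
Qed.

Lemma Fr_F r x : Fr r x -> F x.
Proof.
elim: r x => [|r IH] x xr; first exact: F_scal.
rewrite [x]S_decomp; apply: F_sum => i _; apply: F_sum => j _.
by apply: F_sandwich; apply: IH; apply: xr.
Qed.

Lemma Fr_mono r v t : size v = r -> size t = r -> Fr r (mono v t).
Proof.
elim: r v t => [|r IH] [|i v] [|j t] //=; first by rewrite /mono /= star1 mulr1 => _ _; apply: scal1.
move=> [vr] [tr] l m; rewrite /mono /= starM !mulrA.
have [->|li] := eqVneq l i; last by rewrite (S_orth O_cuntz) // !mul0r; apply: Fr0.
rewrite (S_iso O_cuntz) mul1r -mulrA.
have [->|li] := eqVneq j m; last by rewrite (S_orth O_cuntz) // !mulr0; apply: Fr0.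
by rewrite (S_iso O_cuntz) mulr1; apply: IH.
Qed.

Lemma Fr_compress r x v t : Fr r x -> size v = r -> size t = r ->
  scal (star (word v) * x * word t).
Proof.
elim: r x v t => [|r IH] x [|i v] [|j t] //=; first by rewrite star1 mul1r mulr1.
move=> xr [vr] [tr]; rewrite starM -!mulrA (mulrA x) (mulrA (star (S i))).
by rewrite (mulrA (star (S i)) x) mulrA; apply: IH.
Qed.

(** The eigenvalues of a monomial of nonzero degree cannot all be 1 by [zeta_torsion_free], so its
    averages eventually vanish; a monomial of degree zero is fixed and lies in a matrix algebra. *)
Lemma avg_mono v t : exists K0, forall K, (K0 <= K)%N -> exists r, Fr r (avg K (mono v t)).
Proof.
have [vt|vt] := eqVneq (size v) (size t).
  have fx s : gamma (zeta s) (mono v t) = mono v t by exact: F_mono (norm_zeta _ _).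
  by exists 0%N => K _; exists (size v); rewrite avg_fixed //; apply: Fr_mono.
pose w s : R[i] := zeta s ^+ size v * (zeta s ^+ size t)^*.
have [|s|s|w1|[K0 K0P]] := @avg_eigen w (mono v t).
- by rewrite /w !expr1n conjC1 mulr1.
- by rewrite /w exprMn -rmorphXn -!exprM ![(_ * 2)%N]mulnC !exprM zeta_sqr.
- by rewrite /w gam_mono //; apply: norm_zeta.
- have {}w1 s : zeta s ^+ size v = zeta s ^+ size t.
    have := w1 s; rewrite /w => h.
    by rewrite -[RHS]mul1r -h -mulrA (mulrC _^*) (unit_conj (norm_zeta _ s)) mulr1.
  have key (p q : nat) : (p < q)%N -> (forall s, zeta s ^+ p = zeta s ^+ q) -> False.
    move=> pq pz; have : (q - p)%N = 0%N.
      apply: (@zeta_torsion_free R[i]) => s.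
      have zu : zeta s ^+ p != 0.
        by rewrite expf_neq0 // -normr_eq0 norm_zeta oner_eq0.
      by apply: (mulIf zu); rewrite mul1r -exprD subnK ?pz // ltnW.
    by move/eqP; rewrite subn_eq0 leqNgt pq.
  by case: (ltngtP (size v) (size t)) vt => // vt _; exfalso; apply: key vt _ => s; rewrite w1.
by exists K0 => K /K0P ->; exists 0%N; apply: Fr0.
Qed.

Lemma avg_poly y : wpoly S y -> exists K0, forall K, (K0 <= K)%N -> exists r, Fr r (avg K y).
Proof.
elim=> [c v t|x1 x2 _ [K1 H1] _ [K2 H2]].
  have [K0 K0P] := avg_mono v t; exists K0 => K /K0P[r rP].
  by exists r; rewrite avgZ; apply: FrZ.
exists (maxn K1 K2) => K; rewrite geq_max => /andP[/H1[r1 h1] /H2[r2 h2]].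
exists (maxn r1 r2); rewrite avgD; apply: FrD.
  by apply: Fr_le h1; apply: leq_maxl.
by apply: Fr_le h2; apply: leq_maxr.
Qed.

Lemma dyadic_fixed_approx x (d : R) : (forall s, gamma (zeta s) x = x) -> 0 < d ->
  exists r, exists2 y, Fr r y & nrm (x - y) < d.
Proof.
move=> xf /(word_approx O_cuntz x)[y py xy].
have [K /(_ K (leqnn K))[r ry]] := avg_poly py.
exists r, (avg K y) => //; rewrite -{1}(avg_fixed K xf) -avgB.
exact: le_lt_trans (avg_contractive _ _) xy.
Qed.

Lemma F_approx x (d : R) : F x -> 0 < d ->
  exists r, exists2 y, Fr r y & nrm (x - y) < d.
Proof. by move=> Fx; apply: dyadic_fixed_approx => s; apply: Fx; apply: norm_zeta. Qed.

(** Invariance under the dyadic roots already puts x in the closure of the matrix algebras, hence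
    makes it invariant under the whole circle. Homogeneity can therefore be tested at these
    roots. *)
Lemma dyadic_fixed_F x : (forall s, gamma (zeta s) x = x) -> F x.
Proof.
move=> xf; apply: F_nclosed => d /(dyadic_fixed_approx xf)[r [y /Fr_F ? ?]].
by exists y.
Qed.

End Gauge.

(** * The trace *)

Section Trace.
Context (R : realType) (n : nat) (O : cstarType R) (S : 'I_n -> O)
  (gamma : R[i] -> O -> O) (tau : O -> R[i]).
Context (n_ge2 : (2 <= n)%N) (O_cuntz : is_cuntz S) (gammaP : gauge_action S gamma)
  (tauP : normalized_trace (fixed_algebra gamma) tau).
Implicit Types (x y z a b c w h p q g : O) (D : set O) (v t : seq 'I_n).

Local Notation F := (fixed_algebra gamma).
Local Notation word := (word S).
Local Notation Fr := (Fr S).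
Local Notation T := (S (i0 n_ge2)).
Let F1 := F1 gammaP.
Let F0 := F0 gammaP.
Let FD := FD gammaP.
Let FB := FB gammaP.
Let FM := FM gammaP.
Let FZ := FZ gammaP.
Let F_star := F_star gammaP.

Definition absr (c : R[i]) : R := complex.Re `|c|.

Lemma absrE (c : R[i]) : `|c| = (absr c)%:C%C.
Proof. by rewrite /absr RRe_real // normr_real. Qed.

Lemma absrD (c d : R[i]) : absr (c + d) <= absr c + absr d.
Proof. by rewrite -rcle rmorphD/= -!absrE ler_normD. Qed.

Lemma absrM (c d : R[i]) : absr (c * d) = absr c * absr d.
Proof. by apply: rcI; rewrite rmorphM -!absrE normrM. Qed.

Lemma absr_real (r : R) : absr r%:C%C = `|r|.
Proof.
by rewrite /absr normc_def /= expr0n addr0 sqrtr_sqr.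
Qed.

Lemma absr_eq0 (c : R[i]) : (forall d : R, 0 < d -> absr c <= d) -> c = 0.
Proof.
move=> cd; apply/normr0_eq0; rewrite absrE.
have : absr c <= 0 by apply/ler_addgt0Pr => d d0; rewrite add0r cd.
have : 0 <= absr c by rewrite -rcle -absrE rmorph0 normr_ge0.
by move=> h1 h2; have -> : absr c = 0 by apply: le_anti; rewrite h1 h2.
Qed.

Lemma tauD x y : F x -> F y -> tau (x + y) = tau x + tau y.
Proof. by move=> Fx Fy; have := trace_linear tauP 1 Fx Fy; rewrite scale1r mul1r. Qed.
Lemma tau0 : tau 0 = 0.
Proof. by have := tauD F0 F0; rewrite addr0 => /eqP; rewrite -subr_eq subrr eq_sym => /eqP. Qed.
Lemma tauZ (c : R[i]) x : F x -> tau (c *: x) = c * tau x.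
Proof. by move=> Fx; have := trace_linear tauP c Fx F0; rewrite tau0 !addr0. Qed.
Lemma tauN x : F x -> tau (- x) = - tau x.
Proof. by move=> Fx; rewrite -scaleN1r tauZ // mulN1r. Qed.
Lemma tauB x y : F x -> F y -> tau (x - y) = tau x - tau y.
Proof. by move=> Fx Fy; rewrite tauD ?tauN //; apply: FN gammaP _ Fy. Qed.
Lemma tau_scal (c : R[i]) : tau c%:A = c.
Proof. by rewrite tauZ ?(trace_1 tauP) ?mulr1. Qed.
Lemma tauC x y : F x -> F y -> tau (x * y) = tau (y * x).
Proof. exact: trace_comm. Qed.
Lemma tau_sum (I : finType) (f : I -> O) :
  (forall i, F (f i)) -> tau (\sum_i f i) = \sum_i tau (f i).
Proof.
move=> Ff; pose K x (l : R[i]) := F x /\ tau x = l.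
suff [] : K (\sum_i f i) (\sum_i tau (f i)) by [].
apply: (big_rec2 K); first by split; [exact: F0|exact: tau0].
by move=> i x l _ [Fx <-]; split; [exact: FD|rewrite tauD].
Qed.

(** Positivity of tau is given on elements [star x * x]; here 1 - h = (1 - w)^2 with w self-adjoint
    in F. *)
Lemma tau_le1 h : F h -> star h = h -> nrm h < 1 -> 0 <= 1 - tau h.
Proof.
move=> Fh hs h1.
have [||||w [[Fw ws] _ ww]] := @sqrt_one_sub _ _ (fun w => F w /\ star w = w) h.
- apply: (@nclosedI _ _ F) (@nclosed_sa R O); exact: F_nclosed gammaP.
- by split; [exact: F0|exact: star0].
- move=> w [Fw ws]; split; first by apply/FZ/FD => //; apply: FM.
  by rewrite star_half starD starM hs ws.
- by [].
have F1w : F (1 - w) by apply: FB.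
by have := trace_ge0 tauP F1w; rewrite starB star1 ws ww tauB // (trace_1 tauP).
Qed.

Lemma tau_sa h : F h -> star h = h -> absr (tau h) <= nrm h.
Proof.
move=> Fh hs; apply/ler_addgt0Pr => d d0.
pose t := nrm h + d; have t0 : 0 < t by rewrite ltr_wpDl ?nrm_ge0.
have aux (e : R) : e = 1 \/ e = -1 -> 0 <= 1 - (e / t)%:C%C * tau h.
  move=> e1; rewrite -tauZ //; apply: tau_le1; first exact: FZ.
    by rewrite star_real hs.
  have ne : `|e / t| = t^-1.
    by case: e1 => ->; rewrite normrM ?normrN normr1 mul1r ger0_norm // invr_ge0 ltW.
  by rewrite nrmZ -/(absr _) absr_real ne ltr_pdivrMl // mulr1 ltrDl.
have /aux a1 : (1 : R) = 1 \/ (1 : R) = -1 by left.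
have /aux a2 : (-1 : R) = 1 \/ (-1 : R) = -1 by right.
(* In the order of [R[i]] comparable numbers have equal imaginary parts, so these inequalities also
   show that tau h is real. *)
case E : (tau h) a1 a2 => [u v]; rewrite !lecE /= !(mul0r, add0r, addr0, subr0, oppr0).
move=> /andP[/eqP a1 b1] /andP[/eqP a2 b2].
have ti : 1 / t * t = 1 by rewrite mul1r mulVf // gt_eqF.
have v0 : v = 0 by move: a1; rewrite mul1r => /eqP; rewrite oppr_eq0 mulf_eq0 invr_eq0 gt_eqF //= => /eqP.
rewrite v0 complexr0 absr_real ler_norml; apply/andP; split.
  have : 0 <= (1 - -1 / t * u) * t by rewrite mulr_ge0 // ltW.
  have -> : (1 - -1 / t * u) * t = t + u * (1 / t * t) by ring.
  by rewrite ti /t; lra.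
have : 0 <= (1 - 1 / t * u) * t by rewrite mulr_ge0 // ltW.
have -> : (1 - 1 / t * u) * t = t - u * (1 / t * t) by ring.
by rewrite ti /t; lra.
Qed.

(** The factor 2 comes from adding the bounds for the real and imaginary parts of x; the estimate
    serves for continuity of tau. *)
Lemma tau_bound x : F x -> absr (tau x) <= 2 * nrm x.
Proof.
move=> Fx; pose h := (2^-1 : R[i]) *: (x + star x).
pose k := (2^-1 : R[i]) *: (('i : R[i]) *: (star x - x)).
have xE : x = h + ('i : R[i]) *: k.
  rewrite /k scalerA mulrC -scalerA (scalerA 'i) mulii scaleN1r opprB -scalerDr.
  by rewrite -[LHS]half2; congr (_ *: _); ncring.
have Fh : F h by apply/FZ/FD => //; apply: F_star.
have Fk : F k by apply/FZ/FZ/FB => //; apply: F_star.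
have hs : star h = h by rewrite star_half starD starK addrC.
have ks : star k = k by rewrite star_half starZ starB starK conjCi scaleNr -scalerN opprB.
have h1 : nrm h <= nrm x.
  by rewrite nrmZh; have := nrmD x (star x); rewrite nrm_star; lra.
have k1 : nrm k <= nrm x.
  rewrite nrmZh nrmZ1 ?normCi //.
  by have := nrmB (star x) x; rewrite nrm_star; lra.
rewrite {1}xE tauD //; last exact: FZ.
apply: le_trans (absrD _ _) _; rewrite tauZ // absrM.
have -> : absr 'i = 1 by rewrite /absr normCi.
by have := tau_sa Fh hs; have := tau_sa Fk ks; lra.
Qed.

(** The trace supplies the limit scalar tau x. The error is the distance from x to a scalar plus
    twice that distance from [tau_bound], hence d / 3. *)
Lemma scal_nclosed : nclosed (@scal R O).
Proof.
move=> x xP; have Fx : F x.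
  by apply: (F_nclosed gammaP) => d /xP[y [c ->] xy]; exists c%:A => //; apply/FZ.
exists (tau x); apply/eqP; rewrite -subr_eq0; apply/eqP/nrm_small => d d0.
have [|y [c ->] xy] := xP (d / 3); first lra.
apply: le_trans (nrm_tri c%:A _ _) _; rewrite -scalerBl nrmZ nrm1 mulr1 -/(absr _).
have Fc : F c%:A by apply: FZ.
have := tau_bound (FB Fc Fx); rewrite tauB // tau_scal [nrm (_ - x)]nrmBC; lra.
Qed.

Lemma gauge_commuting_is_scal c : gauge_commuting S c -> scal c.
Proof. by move=> cc; apply: scal_nclosed => d /(gauge_commuting_scal n_ge2 O_cuntz cc). Qed.

Lemma Fr_nclosed r : nclosed (Fr r).
Proof.
elim: r => [|r IH]; first exact: scal_nclosed.
move=> x xP i j; have : nclosed (fun x => Fr r (star (S i) * x * S j)).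
  by apply: (nclosed_preim IH); apply/lip_mulr/lip_mull/lip_id.
by apply=> d /xP[y yr xy]; exists y => //; apply: yr.
Qed.

(** * Scaling of the trace under conjugation by powers of a generator *)

Lemma tau_conj g x : F g -> F x -> star g * g * x = x -> tau (g * x * star g) = tau x.
Proof.
move=> Fg Fx gx; rewrite tauC; [|exact: FM|exact: F_star].
by rewrite mulrA gx.
Qed.

(** The isometries a and b may lie outside F: it is the partial isometry a b^* in F that conjugates
    one argument into the other. *)
Lemma tau_iso a b x : star a * a = 1 -> star b * b = 1 ->
  F (a * star b) -> F (b * x * star b) -> tau (a * x * star a) = tau (b * x * star b).
Proof.
move=> aa bb Fab Fx; have -> : a * x * star a = a * star b * (b * x * star b) * star (a * star b).
  by rewrite starM starK -!mulrA !isoK.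
by apply: tau_conj; rewrite // starM starK -!mulrA !isoK.
Qed.

Lemma tau_iso_orth a b x : star a * a = 1 -> star b * a = 0 ->
  F (a * star a) -> F (a * x * star b) -> tau (a * x * star b) = 0.
Proof.
move=> aa ba Faa Fx; have -> : a * x * star b = a * star a * (a * x * star b).
  by rewrite -!mulrA isoK.
by rewrite tauC // -!mulrA (mulrA (star b)) ba mul0r !mulr0 tau0.
Qed.

Lemma F_compress i j x : F x -> F (star (S i) * x * S j).
Proof.
move=> Fx z z1; rewrite !(gamM gammaP) // (gam_star gammaP) // Fx // !(gauge_gen gammaP) // starZ.
by rewrite -scalerAr -!scalerAl scalerA -[z]expr1 unit_conj // scale1r.
Qed.

Lemma F_pow_S r i j x : F x -> F (T ^+ r * S i * x * star (T ^+ r * S j)).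
Proof.
move=> Fx; have := F_pow_sandwich gammaP (i0 n_ge2) r (F_sandwich gammaP i j Fx).
by rewrite starM !mulrA.
Qed.

Lemma pow_S_word r i : T ^+ r * S i = word (nseq r (i0 n_ge2) ++ [:: i]).
Proof. by rewrite word_cat word_nseq /= mulr1. Qed.

Lemma tau_pow_S r i j x : F x -> tau (T ^+ r * S i * x * star (T ^+ r * S j)) =
  if i == j then tau (T ^+ r.+1 * x * star (T ^+ r.+1)) else 0.
Proof.
move=> Fx.
have WW l : star (T ^+ r * S l) * (T ^+ r * S l) = 1 by rewrite pow_S_word (word_iso O_cuntz).
have [<-|ij] := eqVneq i j.
  apply: tau_iso => //; first exact: pow_iso.
    rewrite pow_S_word -word_nseq; apply: (F_mono gammaP).
    by rewrite size_cat !size_nseq addn1.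
  exact: F_pow_sandwich.
apply: tau_iso_orth => //.
- rewrite starM -mulrA isoK; last exact: pow_iso.
  by rewrite (S_orth O_cuntz) // eq_sym.
- by have := F_pow_S r i i F1; rewrite mulr1.
- exact: F_pow_S.
Qed.

Lemma tau_pow_step r x : F x ->
  tau (T ^+ r * x * star (T ^+ r)) =
  \sum_i tau (T ^+ r.+1 * (star (S i) * x * S i) * star (T ^+ r.+1)).
Proof.
move=> Fx; have Fij := F_compress _ _ Fx.
have -> : T ^+ r * x * star (T ^+ r) =
    \sum_i \sum_j T ^+ r * S i * (star (S i) * x * S j) * star (T ^+ r * S j).
  rewrite {1}[x](S_decomp O_cuntz) mulr_sumr mulr_suml; apply: eq_bigr => i _.
  rewrite mulr_sumr mulr_suml; apply: eq_bigr => j _.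
  by rewrite starM !mulrA.
rewrite tau_sum => [|i]; last by apply: (F_sum gammaP) => j _; apply: F_pow_S.
apply: eq_bigr => i _; rewrite tau_sum => [|j]; last exact: F_pow_S.
rewrite (bigD1 i) //= tau_pow_S // eqxx big1 ?addr0 // => j ji.
by rewrite tau_pow_S // eq_sym (negbTE ji).
Qed.

(* Induction on s for all r at once: compressing x in F_{s+1} to the corners
   S_i^* x S_i trades s for r. *)
Lemma tau_pow_Fr s r x : Fr s x ->
  n%:R ^+ r * tau (T ^+ r * x * star (T ^+ r)) = tau x.
Proof.
have n0 : (n%:R : R[i]) != 0 by rewrite pnatr_eq0 -lt0n (ltnW n_ge2).
elim: s r x => [|s IH] r x.
  have t1 m : n%:R ^+ m * tau (T ^+ m * 1 * star (T ^+ m)) = 1.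
    elim: m => [|m IHm]; first by rewrite expr0 !mul1r star1 (trace_1 tauP).
    rewrite -[RHS]IHm [in RHS](tau_pow_step _ F1) (eq_bigr (fun=> tau (T ^+ m.+1 * 1 * star (T ^+ m.+1)))).
      rewrite (_ : \sum_i _ = n%:R * tau (T ^+ m.+1 * 1 * star (T ^+ m.+1))) ?mulrA -?exprSr //.
      by rewrite sumr_const card_ord mulr_natl.
    by move=> i _; rewrite mulr1 (S_iso O_cuntz).
  have Ft := F_pow_sandwich gammaP (i0 n_ge2) r F1.
  by case=> c ->; rewrite tau_scal -scalerAr -scalerAl (tauZ c Ft) mulrCA t1 mulr1.
move=> xs.
(* The right-hand side does not depend on m, and for m = 0 the left-hand side is tau x. *)
have key m : n%:R ^+ m * tau (T ^+ m * x * star (T ^+ m)) = n%:R^-1 * \sum_i tau (star (S i) * x * S i).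
  rewrite (tau_pow_step _ (Fr_F O_cuntz gammaP xs)) !mulr_sumr; apply: eq_bigr => i _.
  rewrite -(IH m.+1 _ (xs i i)); set t := tau (T ^+ m.+1 * _ * _).
  by rewrite exprS mulrA mulKf.
by rewrite key -(key 0%N) expr0 !mul1r star1 mulr1.
Qed.

Lemma tau_pow r x : F x -> n%:R ^+ r * tau (T ^+ r * x * star (T ^+ r)) = tau x.
Proof.
move=> Fx; apply/eqP; rewrite -subr_eq0; apply/eqP/absr_eq0 => d d0.
pose N := n%:R ^+ r : R.
have N0 : 0 <= N by rewrite exprn_ge0 // ler0n.
(* Replacing x by y costs N times [tau_bound] for the conjugated term and one [tau_bound] for tau x
   itself. *)
pose M := 2 * N + 2; have M0 : 0 < M by rewrite /M; lra.
have [s [y ys xy]] := F_approx O_cuntz gammaP Fx (divr_gt0 d0 M0).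
have Fy := Fr_F O_cuntz gammaP ys.
have FT z : F z -> F (T ^+ r * z * star (T ^+ r)) by apply: F_pow_sandwich gammaP _ _ _.
have -> : n%:R ^+ r * tau (T ^+ r * x * star (T ^+ r)) - tau x =
    n%:R ^+ r * tau (T ^+ r * (x - y) * star (T ^+ r)) + tau (y - x).
  have -> : T ^+ r * (x - y) * star (T ^+ r) = T ^+ r * x * star (T ^+ r) - T ^+ r * y * star (T ^+ r).
    by rewrite mulrBr mulrBl.
  by rewrite (tauB (FT _ Fx) (FT _ Fy)) (tauB Fy Fx) mulrBr (tau_pow_Fr r ys); ring.
apply: le_trans (absrD _ _) _; rewrite absrM.
have -> : absr (n%:R ^+ r) = N.
  by rewrite -(rmorph_nat (real_complex R)) -rmorphXn absr_real ger0_norm.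
have h1 := tau_bound (FB Fy Fx).
have h2 := tau_bound (FT _ (FB Fx Fy)).
have h3 := nrm_sandwich_iso (x - y) (pow_iso O_cuntz r (i0 n_ge2)).
rewrite nrmBC in h1.
have : M * nrm (x - y) <= d by rewrite mulrC -ler_pdivlMr // ltW.
have : N * absr (tau (T ^+ r * (x - y) * star (T ^+ r))) <= N * (2 * nrm (x - y)).
  by rewrite ler_wpM2l //; lra.
rewrite /M; lra.
Qed.

End Trace.

(** * Comparison of projections *)

Section Comparison.
Context (R : realType) (n : nat) (O : cstarType R) (S : 'I_n -> O)
  (gamma : R[i] -> O -> O) (tau : O -> R[i]).
Context (n_ge2 : (2 <= n)%N) (O_cuntz : is_cuntz S) (gammaP : gauge_action S gamma)
  (tauP : normalized_trace (fixed_algebra gamma) tau).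
Implicit Types (x y z a b c w h p q g u : O) (D : set O) (v t : seq 'I_n).

Local Notation F := (fixed_algebra gamma).
Local Notation word := (word S).
Local Notation mono := (mono S).
Local Notation Fr := (Fr S).
Local Notation T := (S (i0 n_ge2)).
Let F1 := F1 gammaP.
Let F0 := F0 gammaP.
Let FD := FD gammaP.
Let FB := FB gammaP.
Let FM := FM gammaP.
Let FZ := FZ gammaP.
Let F_star := F_star gammaP.

(** Murray-von Neumann equivalence in F. *)
Definition mvn p q := exists w, [/\ F w, star w * w = p & w * star w = q].

Lemma sqr_eq0 x : star x * x = 0 -> x = 0.
Proof.
by move=> x0; apply: nrm_eq0; apply/eqP; rewrite -sqrf_eq0 -nrm_starx x0 nrm0.
Qed.

Lemma pisoR w p : star w * w = p -> p * p = p -> star p = p -> w * p = w.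
Proof.
move=> wp pp ps; apply/eqP; rewrite -subr_eq0; apply/eqP/sqr_eq0.
rewrite starB starM ps.
transitivity (p * (star w * w) * p - p * (star w * w) - star w * w * p + star w * w); first ncring.
by rewrite wp !pp; ncring.
Qed.

Lemma pisoL w q : w * star w = q -> q * q = q -> star q = q -> q * w = w.
Proof.
move=> wq qq qs; rewrite -[RHS]starK -(@pisoR (star w) q) ?starK //.
by rewrite starM starK qs.
Qed.

Lemma piso_range w p : star w * w = p -> p * p = p -> star p = p ->
  projection (w * star w).
Proof.
move=> wp pp ps; split; first by rewrite starM starK.
by rewrite mulrA -(mulrA w) wp (pisoR wp).
Qed.

Lemma mvn_sym p q : mvn p q -> mvn q p.
Proof.
by move=> [w [Fw wp wq]]; exists (star w); rewrite starK; split=> //; apply: F_star.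
Qed.

Lemma mvn_trans p q g : projection p -> projection q -> mvn p q -> mvn q g -> mvn p g.
Proof.
move=> [ps pp] [qs qq] [w [Fw wp wq]] [u [Fu uq ug]].
exists (u * w); split; first exact: FM.
  by rewrite starM -mulrA (mulrA (star u)) uq (pisoL wq).
by rewrite starM -mulrA (mulrA w) wq mulrA (pisoR uq).
Qed.

Lemma mvn_add p p' q q' : projection p -> projection p' -> projection q -> projection q' ->
  p * p' = 0 -> q * q' = 0 -> mvn p q -> mvn p' q' -> mvn (p + p') (q + q').
Proof.
move=> [ps pp] [ps' pp'] [qs qq] [qs' qq'] p0 q0 [w [Fw wp wq]] [u [Fu uq ug]].
exists (w + u); split; first exact: FD.
  have h : star w * u = 0.
    by rewrite -(pisoL ug) // -(pisoL wq) // starM qs mulrA -(mulrA (star w)) q0 mulr0 mul0r.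
  have h' : star u * w = 0 by rewrite -[LHS]starK starM starK h star0.
  by rewrite starD mulrDl !mulrDr wp uq h h' addr0 add0r.
have h : w * star u = 0.
  by rewrite -(pisoR wp) // -(pisoR uq) // starM ps' mulrA -(mulrA w) p0 mulr0 mul0r.
have h' : u * star w = 0 by rewrite -[LHS]starK starM starK h star0.
by rewrite starD mulrDl !mulrDr wq ug h h' addr0 add0r.
Qed.

Lemma mvn_tau p q : mvn p q -> tau p = tau q.
Proof. by move=> [w [Fw <- <-]]; apply: (tauC tauP) => //; apply: F_star. Qed.

Lemma proj_tau_ge0 p : F p -> projection p -> 0 <= tau p.
Proof. by move=> Fp [ps pp]; have := trace_ge0 tauP Fp; rewrite ps pp. Qed.

(** A minimal projection of the matrix algebra [Fr r]. *)
Definition pow_proj r := T ^+ r * star (T ^+ r).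

Lemma pow_proj_projection r : projection (pow_proj r).
Proof.
split; first by rewrite starM starK.
by rewrite /pow_proj -!mulrA isoK // pow_iso.
Qed.

Lemma F_pow_proj r : F (pow_proj r).
Proof. by have := F_pow_sandwich gammaP (i0 n_ge2) r F1; rewrite mulr1. Qed.

Lemma n_neq0 : (n%:R : R[i]) != 0.
Proof. by rewrite pnatr_eq0 -lt0n (ltnW n_ge2). Qed.

Lemma tau_pow_proj r : tau (pow_proj r) = n%:R ^- r.
Proof.
have := tau_pow n_ge2 O_cuntz gammaP tauP r F1; rewrite mulr1 (trace_1 tauP) => h.
by apply: (mulfI (expf_neq0 r n_neq0)); rewrite h mulfV ?expf_neq0 ?n_neq0.
Qed.

Lemma tau_pow_proj_gt0 r : 0 < tau (pow_proj r).
Proof. by rewrite tau_pow_proj invr_gt0 exprn_gt0 // ltr0n (ltnW n_ge2). Qed.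

Lemma word_total r x : (forall v, size v = r -> x * word v = 0) -> x = 0.
Proof.
elim: r x => [|r IH] x xv; first by have := xv [::] erefl; rewrite /= mulr1.
rewrite -[x]mulr1 -(cuntz_sum O_cuntz) mulr_sumr big1 // => i _.
rewrite mulrA (IH (x * S i)) ?mul0r // => v vr.
by rewrite -mulrA; apply: (xv (i :: v)); rewrite /= vr.
Qed.

(** Words of length r compress [Fr r] to scalars, so for a word v with p S_v != 0 the element y = p
    S_v T^{*r} satisfies y^* y = l T^r T^{*r}. Positivity of tau gives l > 0, and y is divided by
    the square root of l. *)
Lemma Fr_proj_min r p : projection p -> p != 0 -> Fr r p ->
  exists w, [/\ Fr r w, star w * w = pow_proj r & p * w = w].
Proof.
move=> [ps pp] p0 pr.
have [v vr pv] : exists2 v, size v = r & p * word v != 0.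
  apply: contrapT => h; move/eqP: p0; apply; apply: (@word_total r) => v vr.
  by apply/eqP/negPn/negP => pv; apply: h; exists v.
have [l lE] := Fr_compress pr vr vr.
have TT := pow_iso O_cuntz r (i0 n_ge2).
pose y := p * mono v (nseq r (i0 n_ge2)).
have yE : y = p * word v * star (T ^+ r) by rewrite /y /mono word_nseq mulrA.
have yr : Fr r y by apply: (FrM O_cuntz) => //; apply: (Fr_mono O_cuntz); rewrite ?size_nseq.
have yy : star y * y = l *: pow_proj r.
  rewrite yE !starM starK ps -!mulrA (mulrA p p) pp !mulrA -(mulrA (T ^+ r)).
  by rewrite -(mulrA (T ^+ r)) lE -scalerAr mulr1 -scalerAl.
have Fy := Fr_F O_cuntz gammaP yr.
have l0 : 0 < l.
  rewrite lt_neqAle eq_sym; apply/andP; split.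
    apply/eqP => l0; move/eqP: pv; apply.
    rewrite l0 scale0r in yy; have := sqr_eq0 yy.
    by move/(congr1 (fun x => x * T ^+ r)); rewrite mul0r yE -mulrA TT mulr1.
  have := trace_ge0 tauP Fy; rewrite yy (tauZ gammaP tauP) ?pmulr_lge0 ?tau_pow_proj_gt0 //.
  exact: F_pow_proj.
have s0 : 0 < sqrtC l by rewrite sqrtC_gt0.
exists ((sqrtC l)^-1 *: y); split; first exact: FrZ.
  rewrite starZ -scalerAl -scalerAr scalerA yy scalerA.
  rewrite (conj_Creal (x := (sqrtC l)^-1)) ?realV ?gtr0_real //.
  by rewrite -invfM -expr2 sqrtCK mulVf ?scale1r // gt_eqF.
by rewrite -scalerAr /y mulrA pp.
Qed.

Lemma subprojection p q : projection p -> projection q -> p * q = q ->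
  projection (p - q) /\ q * (p - q) = 0.
Proof.
move=> [ps pp] [qs qq] pq; have qp : q * p = q by rewrite -{1}qs -{1}ps -starM pq.
split; last by rewrite mulrBr qp qq subrr.
by split; rewrite ?starB ?ps ?qs // mulrBr !mulrBl pp pq qp qq subrr subr0.
Qed.

Lemma Fr_proj_split r p : projection p -> p != 0 -> Fr r p ->
  exists q, [/\ Fr r q, projection q, p * q = q & mvn (pow_proj r) q].
Proof.
move=> pp p0 pr; have [w [wr wE pw]] := Fr_proj_min pp p0 pr.
have [es ee] := pow_proj_projection r.
exists (w * star w); split; last by exists w; split => //; apply: Fr_F gammaP _ _ wr.
- by apply: (FrM O_cuntz) => //; apply: Fr_star.
- exact: piso_range wE ee es.
- by rewrite mulrA pw.
Qed.

Lemma tau_proj_split r p q : F p -> F q -> mvn (pow_proj r) q ->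
  tau (p - q) = tau p - n%:R ^- r.
Proof.
by move=> Fp Fq /mvn_tau e; rewrite (tauB gammaP tauP) // -e tau_pow_proj.
Qed.

Lemma Fr_proj_tau_gt0 r p : projection p -> p != 0 -> Fr r p -> 0 < tau p.
Proof.
move=> pp p0 pr; have [q [qr qq pq eq]] := Fr_proj_split pp p0 pr.
have Fp := Fr_F O_cuntz gammaP pr; have Fq := Fr_F O_cuntz gammaP qr.
have [dp _] := subprojection pp qq pq.
have := proj_tau_ge0 (FB Fp Fq) dp; rewrite (tau_proj_split Fp Fq eq) subr_ge0.
by apply: lt_le_trans; rewrite -tau_pow_proj tau_pow_proj_gt0.
Qed.

(** Each step splits a minimal projection off p and another off q, which lowers both traces by n^-r.
    N bounds the number of steps, and a projection of [Fr r] with trace 0 is 0. *)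
Lemma Fr_compare_bounded r N p q : projection p -> projection q -> Fr r p -> Fr r q ->
  tau p = tau q -> tau p <= N%:R * n%:R ^- r -> mvn p q.
Proof.
elim: N p q => [|N IH] p q pp qq pr qr pq pN.
  have z g : projection g -> Fr r g -> tau g <= 0 -> g = 0.
    move=> gg gr g0; apply/eqP/negPn/negP => /(Fr_proj_tau_gt0 gg)/(_ gr).
    by move=> /lt_le_trans/(_ g0); rewrite ltxx.
  rewrite mul0r in pN; rewrite (z p) // (z q) -?pq //.
  by exists 0; rewrite mulr0 mul0r; split=> //; apply: F0.
have [p0|p0] := eqVneq p 0.
  have [->|/(Fr_proj_tau_gt0 qq)/(_ qr)] := eqVneq q 0.
    by rewrite p0; exists 0; rewrite mulr0 mul0r; split=> //; apply: F0.
  by rewrite -pq p0 (tau0 gammaP tauP) ltxx.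
have q0 : q != 0.
  by apply: contra_eq_neq pq => ->; rewrite (tau0 gammaP tauP) gt_eqF // (Fr_proj_tau_gt0 pp p0 pr).
have [p' [pr' pp' pq' ep]] := Fr_proj_split pp p0 pr.
have [q' [qr' qq' qp' eq]] := Fr_proj_split qq q0 qr.
have [dp op] := subprojection pp pp' pq'.
have [dq oq] := subprojection qq qq' qp'.
have FF := Fr_F O_cuntz gammaP.
rewrite -(subrKC p' p) -(subrKC q' q); apply: mvn_add => //.
  apply: mvn_trans pp' (pow_proj_projection r) (mvn_sym ep) eq.
have tp := tau_proj_split (FF _ _ pr) (FF _ _ pr') ep.
apply: IH; rewrite // ?(tau_proj_split (FF _ _ qr) (FF _ _ qr') eq) ?tp ?pq //; try exact: FrB.
by rewrite lerBlDr -pq; move: pN; rewrite -natr1 mulrDl mul1r.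
Qed.

Lemma Fr_compare r p q : projection p -> projection q -> Fr r p -> Fr r q ->
  tau p = tau q -> mvn p q.
Proof.
(* The count n^r is enough because tau p <= tau 1 = 1 = n^r n^-r. *)
move=> pp qq pr qr pq; apply: (@Fr_compare_bounded r (n ^ r) p q) => //.
rewrite natrX mulfV ?expf_neq0 ?n_neq0 // -(trace_1 tauP) -subr_ge0.
have Fp := Fr_F O_cuntz gammaP pr.
by rewrite -(tauB gammaP tauP) //; apply: proj_tau_ge0 (FB F1 Fp) (projectionC pp).
Qed.

(* The unitary part of q p in the polar decomposition; y^2 = 1 - p + p q p. *)
Lemma mvn_close p q : F p -> F q -> projection p -> projection q -> nrm (p - q) < 1 -> mvn p q.
Proof.
move=> Fp Fq pp qq pq1; have [ps ppp] := pp; have [qs qqq] := qq.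
pose a := p - p * q * p.
have Fa : F a by apply/FB => //; apply/FM => //; apply: FM.
have as_ : star a = a by rewrite starB !starM ps qs mulrA.
have ap : a * p = a by rewrite /a mulrBl -[X in _ - X]mulrA ppp.
have a1 : nrm a < 1.
  apply: le_lt_trans pq1; have -> : a = p * (p - q) * p by rewrite mulrBr mulrBl !ppp.
  have := nrmM (p * (p - q)) p; have := nrmM p (p - q); have := nrm_proj pp.
  have := nrm_ge0 p; have := nrm_ge0 (p - q); have := nrm_ge0 (p * (p - q)); nra.
have [||||w [[[Fw ws] wp] wa ww]] := @sqrt_one_sub _ _ (fun w => (F w /\ star w = w) /\ w * p = w) a.
- apply: nclosedI; first by apply: nclosedI; [exact: F_nclosed gammaP|exact: nclosed_sa].
  by apply: nclosed_eq; [apply: lip_mulr; apply: lip_id|apply: lip_id].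
- by rewrite star0 mul0r; split=> //; split=> //; apply: F0.
- move=> w [[Fw ws] wp]; rewrite star_half starD starM ws as_ -scalerAl mulrDl ap -mulrA wp.
  by split=> //; split=> //; apply/FZ/FD => //; apply: FM.
- by [].
have w1 : nrm w < 1 by apply: le_lt_trans a1.
have [|||z [[[[Fz zs] zp] zw] _ zz]] :=
    @neumann _ _ (fun z => ((F z /\ star z = z) /\ z * p = z) /\ w * z = z * w) w _ _ _ w1.
- apply: nclosedI; last exact: nclosed_commute.
  apply: nclosedI; first by apply: nclosedI; [exact: F_nclosed gammaP|exact: nclosed_sa].
  by apply: nclosed_eq; [apply: lip_mulr; apply: lip_id|apply: lip_id].
- by rewrite star0 !mul0r mulr0; split=> //; split=> //; split=> //; apply: F0.
- move=> z [[[Fz zs] zp] zw]; split; last by rewrite mulrDr mulrDl -mulrA zw.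
  rewrite starD starM ws zs -zw mulrDl wp -mulrA zp; split=> //; split=> //.
  by apply: FD => //; apply: FM.
pose y := 1 - w; pose g := 1 + z.
have gs : star g = g by rewrite starD star1 zs.
have Fg : F g by apply: FD.
have yg : y * g = 1 by [].
have gy : g * y = 1.
  by rewrite -yg /g /y; transitivity (1 + z - w - z * w); [|rewrite -zw]; ncring.
have pz : p * z = z by rewrite -{1}zs -{1}ps -starM zp.
have g1p : g * (1 - p) = 1 - p.
  by rewrite mulrBr mulr1 /g mulrDl mul1r zp; ncring.
have pg : p * g = g * p by rewrite /g mulrDl mulrDr mul1r mulr1 zp pz.
have pqp : p * q * p = y * y - (1 - p) by rewrite ww /a; ncring.
have WW : star (q * p * g) * (q * p * g) = p.
  rewrite !starM qs ps gs.
  transitivity (g * (p * (q * q) * p) * g); first by rewrite !mulrA.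
  rewrite qqq pqp mulrBr mulrBl mulrA gy mul1r yg g1p mulrBl mul1r pg.
  by rewrite -[X in _ - (X - _)]mulr1 -mulrBr g1p; ncring.
exists (q * p * g); split; [by apply: FM => //; apply: FM|exact: WW|].
pose W := q * p * g; pose f := W * star W.
have [fs ff] : projection f by apply: piso_range WW ppp ps.
have qf : q * f = f by rewrite /f /W !mulrA qqq.
have fq : f * q = f by rewrite -{1}fs -{1}qs -starM qf.
have fqp : f * (q * p) = q * p.
  have -> : f * (q * p) = W * (g * (p * (q * q) * p)).
    by rewrite /f [in X in _ * X * _]/W !starM ps qs gs !mulrA.
  rewrite qqq pqp mulrBr mulrA gy mul1r g1p mulrBr /W -!mulrA gy mulr1 g1p.
  by rewrite (mulrBr p) ppp mulr1 subrr mulr0 subr0.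
apply/esym/eqP; rewrite -/f -subr_eq0; apply/eqP/nrm_eq0.
(* The projection f lies under q and f q p = q p, so (q - f) (q - p) = q - f; as nrm (p - q) < 1,
   this leaves only q = f. *)
have d1 : nrm (q - f) <= nrm (q - f) * nrm (p - q).
  rewrite [nrm (p - q)]nrmBC; apply: le_trans (nrmM _ _).
  suff -> : (q - f) * (q - p) = q - f by [].
  have -> : (q - f) * (q - p) = q * q - f * q - q * p + f * p by ncring.
  by rewrite -{2}fq -(mulrA f) fqp qqq fq; ncring.
by have := nrm_ge0 (q - f); nra.
Qed.

(* With y^2 = 1 - 4 (x - x^2), the symmetry (2 x - 1) y^-1 is close to 2 x - 1. *)
Lemma Fr_proj_near r x p : Fr r x -> projection p -> nrm (x - p) < 128^-1 ->
  exists q, [/\ Fr r q, projection q & nrm (q - p) < 1].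
Proof.
wlog xs : x / star x = x.
  move=> H xr pp xp; have [ps _] := pp.
  apply: (H ((2^-1 : R[i]) *: (x + star x))) => //.
  - by rewrite star_half starD starK addrC.
  - by apply/FrZ/FrD => //; apply: Fr_star.
  - apply: le_lt_trans xp; rewrite -[p in X in X <= _]half2 -scalerBr nrmZh.
    have -> : x + star x - (p + p) = (x - p) + star (x - p) by rewrite starB ps; ncring.
    by have := nrmD (x - p) (star (x - p)); rewrite nrm_star; lra.
move=> xr pp xp; have [ps ppp] := pp.
have pn := nrm_proj pp.
(* The constant: nrm b <= 4 d gives nrm a <= 16 d <= 1/8, hence nrm w <= 1/8 and nrm z <= (1/8) /
   (7/8) = 1/7. As nrm c <= 4, the final distance is at most 2/7 + d < 1. *)
set d := nrm (x - p) in xp; have d0 : 0 <= d := nrm_ge0 _.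
have xn : nrm x <= 1 + d.
  by rewrite -(subrK p x) addrC; apply: le_trans (nrmD _ _) _; rewrite lerD2r.
pose b := x - x * x; pose a := b + b + (b + b).
have bn : nrm b <= 4 * d.
  have -> : b = (x - p) - (x * (x - p) + (x - p) * p).
    by rewrite /b; transitivity (x - p - (x * x - p * p)); [rewrite ppp|]; ncring.
  have := nrmB (x - p) (x * (x - p) + (x - p) * p).
  have := nrmD (x * (x - p)) ((x - p) * p).
  have := nrmM x (x - p); have := nrmM (x - p) p; rewrite -/d; nra.
have an : nrm a <= 8^-1.
  by rewrite /a; have := nrmD (b + b) (b + b); have := nrmD b b; lra.
have as_ : star a = a by rewrite /a /b !starD starN starM xs.
have ar : Fr r a by do 2!apply: FrD; apply: FrB => //; apply: FrM.
have ax : x * a = a * x by rewrite /a /b; ncring.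
have a1 : nrm a < 1 by lra.
have [||||w [[[Fw ws] wx] wa ww]] :=
    @sqrt_one_sub _ _ (fun w => (Fr r w /\ star w = w) /\ x * w = w * x) a.
- apply: nclosedI; last exact: nclosed_commute.
  by apply: nclosedI; [exact: Fr_nclosed gammaP tauP _|exact: nclosed_sa].
- by rewrite star0 mul0r mulr0; split=> //; split=> //; apply: Fr0.
- move=> w [[Fw ws] wx]; split; last by apply: commute_half; rewrite // mulrA wx -mulrA wx mulrA.
  by rewrite star_half starD starM ws as_; split=> //; apply/FrZ/FrD => //; apply: FrM.
- by [].
have w1 : nrm w < 1 by apply: le_lt_trans a1.
have [|||z [[[[Fz zs] zx] zw] zn zz]] :=
    @neumann _ _ (fun z => ((Fr r z /\ star z = z) /\ x * z = z * x) /\ w * z = z * w) w _ _ _ w1.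
- apply: nclosedI; last exact: nclosed_commute.
  apply: nclosedI; last exact: nclosed_commute.
  by apply: nclosedI; [exact: Fr_nclosed gammaP tauP _|exact: nclosed_sa].
- by rewrite star0 !mul0r !mulr0; split=> //; split=> //; split=> //; apply: Fr0.
- move=> z [[[Fz zs] zx] zw]; split; last by rewrite mulrDr mulrDl -mulrA zw.
  split; last by rewrite mulrDr mulrDl wx mulrA wx -mulrA zx mulrA.
  by rewrite starD starM ws zs -zw; split=> //; apply: FrD => //; apply: FrM.
pose c := x + x - 1; pose g := 1 + z.
have cg : c * g = g * c.
  rewrite /c /g; transitivity (x + x - 1 + x * z + x * z - z); first ncring.
  by rewrite zx; ncring.
have ss : c * g * (c * g) = 1.
  transitivity (c * c * (g * g)); first by rewrite -mulrA (mulrA g) -cg !mulrA.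
  have -> : c * c = (1 - w) * (1 - w) by rewrite ww /a /b /c; ncring.
  by rewrite /g -mulrA (mulrA (1 - w) (1 + z)) zz mul1r zz.
pose s := 1 + c * g.
have s2 : s * s = s + s by rewrite /s; transitivity (1 + c * g + c * g + c * g * (c * g)); [|rewrite ss]; ncring.
exists ((2^-1 : R[i]) *: s); split.
- apply/FrZ/FrD; first exact: Fr1.
  by apply: FrM => //; [do 2?apply: FrB => //; [exact: FrD|exact: Fr1]|apply: FrD => //; exact: Fr1].
- split; last by rewrite -scalerAl -scalerAr s2 half2.
  have cs : star c = c by rewrite /c starB starD xs star1.
  by rewrite star_half /s starD star1 starM cs {1}/g starD star1 zs -/g -cg.
have -> : (2^-1 : R[i]) *: s - p = (2^-1 : R[i]) *: (c * z) + (x - p).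
  rewrite -[in RHS](half2 x) addrA -scalerDr; congr (_ *: _ - _).
  by rewrite /s /c /g; ncring.
apply: le_lt_trans (nrmD _ _) _; rewrite nrmZh -/d.
have z1 : nrm z <= 7^-1.
  have : nrm w <= 8^-1 by apply: le_trans an.
  by have := nrm_ge0 z; nra.
have cn : nrm c <= 4.
  have := nrmB (x + x) 1; have := nrmD x x; rewrite nrm1 -/c; lra.
have := nrmM c z; have := nrm_ge0 c; have := nrm_ge0 z; nra.
Qed.

Lemma F_proj_Fr p : F p -> projection p ->
  exists r q, [/\ Fr r q, projection q & mvn p q].
Proof.
move=> Fp pp; have e0 : 0 < (128^-1 : R) by rewrite invr_gt0.
have [r [x xr]] := F_approx O_cuntz gammaP Fp e0.
rewrite nrmBC => /(Fr_proj_near xr pp)[q [qr qq]]; rewrite nrmBC => pq.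
by exists r, q; split=> //; apply: mvn_close => //; apply: Fr_F gammaP _ _ qr.
Qed.

Lemma F_compare p q : F p -> F q -> projection p -> projection q -> tau p = tau q -> mvn p q.
Proof.
move=> Fp Fq pp qq pq.
have [r [p' [pr pp' ep]]] := F_proj_Fr Fp pp.
have [s [q' [qs qq' eq]]] := F_proj_Fr Fq qq.
apply: (mvn_trans pp pp' ep); apply: (mvn_trans pp' qq' _ (mvn_sym eq)).
apply: (@Fr_compare (maxn r s)) => //.
- by apply: Fr_le O_cuntz _ _ _ (leq_maxl r s) pr.
- by apply: Fr_le O_cuntz _ _ _ (leq_maxr r s) qs.
- by rewrite -(mvn_tau ep) -(mvn_tau eq).
Qed.

Lemma F_proj_min p : F p -> projection p -> p != 0 ->
  exists r w, [/\ F w, star w * w = pow_proj r & p * w = w].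
Proof.
move=> Fp pp p0; have [ps ppp] := pp; have [r [q [qr qq [u [Fu uu uq]]]]] := F_proj_Fr Fp pp.
have [qs qqq] := qq.
have q0 : q != 0.
  apply: contra_neq p0 => q0; rewrite -uu.
  by rewrite -(pisoL uq) // q0 mul0r mulr0.
have [w [wr we qw]] := Fr_proj_min qq q0 qr.
have Fw := Fr_F O_cuntz gammaP wr.
exists r, (star u * w); split.
- by apply: FM => //; apply: F_star.
- by rewrite starM starK -mulrA (mulrA u) uq qw.
- by rewrite mulrA -{1}ps -starM (pisoR uu).
Qed.

Lemma F_proj_tau_gt0 p : F p -> projection p -> p != 0 -> 0 < tau p.
Proof.
move=> Fp pp p0; have [ps ppp] := pp; have [r [q [qr qq pq]]] := F_proj_Fr Fp pp.
rewrite (mvn_tau pq); apply: Fr_proj_tau_gt0 qr => //.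
have [u [_ uu uq]] := pq; have [qs qqq] := qq; apply: contra_neq p0 => q0.
by rewrite -uu -(pisoL uq) // q0 mul0r mulr0.
Qed.

End Comparison.

(** * Relative commutants and homogeneity *)

Section Commutant.
Context (R : realType) (n : nat) (O : cstarType R) (S : 'I_n -> O)
  (gamma : R[i] -> O -> O) (tau : O -> R[i]).
Context (n_ge2 : (2 <= n)%N) (O_cuntz : is_cuntz S) (gammaP : gauge_action S gamma)
  (tauP : normalized_trace (fixed_algebra gamma) tau).
Implicit Types (x y z a b c w h p q g u v : O) (D : set O).

Local Notation F := (fixed_algebra gamma).
Local Notation word := (word S).
Local Notation mono := (mono S).
Local Notation T := (S (i0 n_ge2)).
Local Notation zeta := (@zeta R[i]).
Let F1 := F1 gammaP.
Let FM := FM gammaP.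
Let F_star := F_star gammaP.

(** The isometry a = w T^r has range under p and a F a^* is in F, so a^* c a commutes with the
    gauge-invariant monomials and is a scalar l. Then d = c - l p satisfies a^* d a = 0; commuting
    with a a^*, it kills a, and commuting with pFp, it kills p S_v for every word v of length r. *)
Lemma corner_commutant p c : F p -> projection p -> p != 0 -> p * c = c -> c * p = c ->
  (forall x, F x -> c * (p * x * p) = p * x * p * c) -> exists l : R[i], c = l *: p.
Proof.
move=> Fp pp p0 pc cp cF; have [ps ppp] := pp.
have [r [w [Fw we pw]]] := F_proj_min n_ge2 O_cuntz gammaP tauP Fp pp p0.
have TT := pow_iso O_cuntz r (i0 n_ge2).
have [a aE] : exists a, a = w * T ^+ r by exists (w * T ^+ r).
have aa : star a * a = 1.
  by rewrite aE starM -mulrA (mulrA (star w)) we /pow_proj -!mulrA TT mulr1 TT.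
have pa : p * a = a by rewrite aE mulrA pw.
have ap : star a * p = star a by rewrite -{1}ps -starM pa.
have Fa M : F M -> F (a * M * star a).
  move=> FM_; have -> : a * M * star a = w * (T ^+ r * M * star (T ^+ r)) * star w.
    by rewrite aE starM !mulrA.
  by apply: FM; [apply: FM => //; exact: F_pow_sandwich|exact: F_star].
have cM M : F M -> c * (a * M * star a) = a * M * star a * c.
  move=> FM_; have <- : p * (a * M * star a) * p = a * M * star a.
    by rewrite !mulrA pa -mulrA ap.
  by apply: cF; apply: Fa.
have [l lE] : scal (star a * c * a).
  apply: (gauge_commuting_is_scal n_ge2 O_cuntz gammaP tauP) => v t vt.
  have FM_ := F_mono gammaP vt; move: (mono v t) FM_ => M FM_.
  transitivity (star a * (c * (a * M * star a)) * a).
    by rewrite -!mulrA aa mulr1.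
  by rewrite cM // -!mulrA isoK.
exists l; pose d := c - l *: p.
have dF x : F x -> d * (p * x * p) = p * x * p * d.
  move=> Fx; rewrite /d mulrBl mulrBr cF // -scalerAl -scalerAr.
  by rewrite -[p * x * p * p]mulrA ppp !mulrA ppp.
have dp : d * p = d by rewrite /d mulrBl cp -scalerAl ppp.
have ada : star a * d * a = 0.
  by rewrite /d mulrBr mulrBl lE -scalerAr -scalerAl ap aa subrr.
have da : d * a = 0.
  have -> : d * a = d * (p * (a * 1 * star a) * p) * a.
    by rewrite mulr1 (mulrA p) pa -!mulrA (mulrA (star a) p) ap aa mulr1.
  rewrite dF; last exact: Fa.
  by rewrite mulr1 (mulrA p) pa -!mulrA (mulrA (star a) p) ap (mulrA (star a)) ada mulr0.
apply/eqP; rewrite -subr_eq0 -/d -dp; apply/eqP/(word_total O_cuntz (r := r)) => v vr.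
have Fva : F (word v * star a).
  have -> : word v * star a = mono v (nseq r (i0 n_ge2)) * star w.
    by rewrite aE starM /mono word_nseq mulrA.
  by apply: FM; [apply: F_mono gammaP _ _ _; rewrite size_nseq|exact: F_star].
have -> : d * p * word v = d * (p * (word v * star a) * p) * a.
  by rewrite -!mulrA pa aa mulr1.
by rewrite dF // -mulrA da mulr0.
Qed.

Lemma gam_pow (z : R[i]) m : `|z| = 1 -> gamma z (T ^+ m) = z ^+ m *: T ^+ m.
Proof. by move=> z1; rewrite -word_nseq (gam_word gammaP) // size_nseq. Qed.

(** * Partial isometries that carry a corner of F into F *)

Section Transporter.
Context (p q v : O) (Fp : F p) (Fq : F q) (pp : projection p) (qq : projection q)
  (p0 : p != 0) (vp : star v * v = p) (vq : v * star v = q)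
  (vF : forall x, F x -> F (v * (p * x * p) * star v)).

Let ps : star p = p. Proof. by case: pp. Qed.
Let ppp : p * p = p. Proof. by case: pp. Qed.
Let qs : star q = q. Proof. by case: qq. Qed.
Let qqq : q * q = q. Proof. by case: qq. Qed.

(* v^* gamma_z(v) commutes with pFp, because v (pFp) v^* consists of fixed points. *)
Lemma transporter_eigen (z : R[i]) : `|z| = 1 -> exists l : R[i], gamma z v = l *: v.
Proof.
move=> z1; have vp' := pisoR vp ppp ps; have qv := pisoL vq qqq qs.
have gp : gamma z v * p = gamma z v by rewrite -{1}(Fp z1) -(gamM gammaP z1) vp'.
have qg : q * gamma z v = gamma z v by rewrite -{1}(Fq z1) -(gamM gammaP z1) qv.
have pv : p * star v = star v by rewrite -{1}ps -starM vp'.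
have [||x Fx|l lE] := @corner_commutant p (star v * gamma z v) Fp pp p0.
- by rewrite mulrA pv.
- by rewrite -mulrA gp.
- set X := p * x * p; have pX : p * X = X by rewrite /X !mulrA ppp.
  have FX : F X by apply: FM => //; apply: FM.
  have Xp : X * p = X by rewrite /X -mulrA ppp.
  have vFX : F (v * X * star v) by apply: vF.
  clearbody X; have gX : gamma z v * X = v * X * star v * gamma z v.
    rewrite -{1}(FX _ z1) -(gamM gammaP z1) -{1}(vFX _ z1) -(gamM gammaP z1).
    by rewrite -(mulrA _ (star v)) vp -mulrA Xp.
  by rewrite -mulrA gX !mulrA vp pX.
by exists l; rewrite -qg -vq -mulrA lE -scalerAr vp'.
Qed.

Let v_neq0 : v != 0.
Proof. by apply: contra_neq p0 => v0; rewrite -vp v0 mulr0. Qed.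

(** Averaging fixes v^* v = p and is contractive, so the average of v^* y stays at distance less
    than 1 from p, which has norm 1. *)
Lemma transporter_avg_neq0 y K : nrm (v - y) < 1 -> avg gamma K (star v * y) != 0.
Proof.
move=> vy; apply/eqP => a0.
have v1 : nrm v = 1.
  have := nrm_starx v; rewrite vp (nrm_proj1 pp p0); have := nrm_ge0 v; nra.
have h : p = avg gamma K (star v * (v - y)).
  rewrite mulrBr (avgB gammaP) a0 subr0 vp avg_fixed // => s.
  by apply: Fp; apply: norm_zeta.
have := avg_contractive gammaP K (star v * (v - y)); rewrite -h (nrm_proj1 pp p0).
have := nrmM (star v) (v - y); rewrite nrm_star v1; lra.
Qed.

(** For a polynomial y near v the averages of v^* y never vanish, so those of v^* S_al S_be^* do not
    eventually vanish for some words al, be. By [avg_eigen] its eigenvalues are all 1, which makes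
    the eigenvalues of v those of degree |al| - |be|. *)
Lemma transporter_homogeneous : exists m, F (v * star (T ^+ m)) \/ F (star v * star (T ^+ m)).
Proof.
have /choice[l lP] : forall s, exists l : R[i], gamma (zeta s) v = l *: v.
  by move=> s; apply: transporter_eigen; apply: norm_zeta.
have scaleI (c d : R[i]) x : x != 0 -> c *: x = d *: x -> c = d.
  move=> x0 /eqP; rewrite -subr_eq0 -scalerBl scaler_eq0 (negbTE x0) orbF subr_eq0.
  by move/eqP.
have l0 : l 0%N = 1.
  by apply: (scaleI _ _ v) => //; rewrite -lP (gauge_1 gammaP) scale1r.
have ls s : l s.+1 ^+ 2 = l s.
  have gg (z : R[i]) : `|z| = 1 -> gamma (z * z) v = gamma z (gamma z v).
    by move=> z1; exact: (gauge_mul gammaP).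
  apply: (scaleI _ _ v) => //; rewrite -lP -(zeta_sqr R[i] s) [zeta _ ^+ 2]expr2.
  by rewrite gg ?norm_zeta // lP (gamZ gammaP (norm_zeta _ s.+1)) lP scalerA expr2.
have ll s : l s * (l s)^* = 1.
  apply: (scaleI _ _ p) => //; rewrite scale1r -{2}(Fp (norm_zeta _ s)) -{1}vp -[in RHS]vp.
  rewrite (gamM gammaP) ?norm_zeta // (gam_star gammaP) ?norm_zeta // lP starZ.
  by rewrite -scalerAl -scalerAr scalerA mulrC.
have [y yP vy] := word_approx O_cuntz v (ltr01 : 0 < (1 : R)).
pose a (al be : seq 'I_n) := star v * mono al be.
pose w (al be : seq 'I_n) s : R[i] := (l s)^* * (zeta s ^+ size al * (zeta s ^+ size be)^*).
have aw al be s : gamma (zeta s) (a al be) = w al be s *: a al be.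
  rewrite /a (gamM gammaP) ?norm_zeta // (gam_star gammaP) ?norm_zeta // lP starZ.
  by rewrite (gam_mono gammaP) ?norm_zeta // -scalerAl -scalerAr scalerA.
have [al [be abP]] : exists al be, ~ exists K0, forall K, (K0 <= K)%N -> avg gamma K (a al be) = 0.
  apply: contrapT => h.
  have {}h al be : exists K0, forall K, (K0 <= K)%N -> avg gamma K (a al be) = 0.
    by apply: contrapT => h'; apply: h; exists al, be.
  suff [K0 K0P] : exists K0, forall K, (K0 <= K)%N -> avg gamma K (star v * y) = 0.
    by have := transporter_avg_neq0 K0 vy; rewrite K0P // eqxx.
  clear vy; elim: yP => [c al be|x1 x2 _ [K1 H1] _ [K2 H2]].
    have [K0 K0P] := h al be; exists K0 => K /K0P aK.
    by rewrite -scalerAr (avgZ gammaP) aK scaler0.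
  exists (maxn K1 K2) => K; rewrite geq_max => /andP[/H1 h1 /H2 h2].
  by rewrite mulrDr (avgD gammaP) h1 h2 addr0.
have w1 s : w al be s = 1.
  have [|t|//|//] := avg_eigen gammaP _ _ (aw al be).
  - by rewrite /w l0 /= !expr1n conjC1 !mulr1.
  - by rewrite /w !exprMn -!rmorphXn ls -!exprM ![(_ * 2)%N]mulnC !exprM zeta_sqr.
have lE s : l s = zeta s ^+ size al * (zeta s ^+ size be)^*.
  by rewrite -[RHS]mul1r -(ll s) -mulrA -/(w al be s) w1 mulr1.
have uc s m : zeta s ^+ m * (zeta s ^+ m)^* = 1 by apply: unit_conj; apply: norm_zeta.
(* The sign of the degree |al| - |be| decides whether v or its adjoint is multiplied by T^{*m}. *)
have [ab|/ltnW ba] := leqP (size be) (size al).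
  exists (size al - size be)%N; left; apply: (dyadic_fixed_F O_cuntz gammaP) => s.
  rewrite (gamM gammaP) ?norm_zeta // (gam_star gammaP) ?norm_zeta // gam_pow ?norm_zeta //.
  rewrite starZ lP lE -scalerAl -scalerAr scalerA.
  by rewrite -{1}(subnK ab) exprD -(mulrA (zeta s ^+ _)) uc mulr1 uc scale1r.
exists (size be - size al)%N; right; apply: (dyadic_fixed_F O_cuntz gammaP) => s.
rewrite (gamM gammaP) ?norm_zeta // !(gam_star gammaP) ?norm_zeta // gam_pow ?norm_zeta //.
have e : (l s)^* * (zeta s ^+ (size be - size al))^* = 1.
  by rewrite -rmorphM lE mulrAC -exprD subnKC // uc rmorph1.
by rewrite lP !starZ -scalerAl -scalerAr scalerA e scale1r.
Qed.

(** In the first case v T^{*m} is a partial isometry of F from T^m p T^{*m}, whose trace is n^-m tau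
    p, to q; the second exchanges p and q. *)
Lemma transporter_tau : exists m,
  F (v * star (T ^+ m)) /\ n%:R ^+ m * tau q = tau p \/
  F (star v * star (T ^+ m)) /\ n%:R ^+ m * tau p = tau q.
Proof.
have tp m x : F x -> n%:R ^+ m * tau (T ^+ m * x * star (T ^+ m)) = tau x.
  exact: (tau_pow n_ge2 O_cuntz gammaP tauP).
have [m [Fv|Fv]] := transporter_homogeneous; exists m; [left|right]; split=> //.
  rewrite -(tp m p Fp); congr (_ * _); apply/esym/(mvn_tau gammaP tauP).
  exists (v * star (T ^+ m)); split=> //; first by rewrite starM starK -!mulrA (mulrA (star v)) vp.
  by rewrite starM starK -!mulrA isoK // pow_iso.
rewrite -(tp m q Fq); congr (_ * _); apply/esym/(mvn_tau gammaP tauP).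
exists (star v * star (T ^+ m)); split=> //.
  by rewrite starM !starK -!mulrA (mulrA v) vq.
by rewrite starM !starK -!mulrA isoK // pow_iso.
Qed.

(** Since tau p is nonzero and n >= 2, equal traces force m = 0. *)
Lemma transporter_F : tau p = tau q -> F v.
Proof.
have tp0 : tau p != 0 by rewrite gt_eqF // (F_proj_tau_gt0 n_ge2 O_cuntz gammaP tauP).
have n1 m : n%:R ^+ m * tau p = tau p -> m = 0%N.
  move=> /eqP; rewrite -[X in _ == X]mul1r (inj_eq (mulIf tp0)) -natrX -[X in _ == X]/(1%:R) eqr_nat.
  by rewrite -[X in _ == X](expn0 n) eqn_exp2l // => /eqP.
move=> pq; have [m [[Fv]|[Fv]]] := transporter_tau; rewrite -pq => /n1 m0.
  by rewrite m0 expr0 star1 mulr1 in Fv.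
by rewrite m0 expr0 star1 mulr1 in Fv; rewrite -[v]starK; apply: F_star.
Qed.

End Transporter.

(** Equivalence in O_n by a v that exchanges the corners pFp and qFq; conjugation by v sees only the
    corner, so the condition can be put on all of F. *)
Definition linked p q := exists v, [/\ star v * v = p, v * star v = q,
  (forall x, F x -> F (v * x * star v)) & (forall x, F x -> F (star v * x * v))].

Lemma linked_sym p q : linked p q -> linked q p.
Proof. by move=> [v [vp vq h1 h2]]; exists (star v); rewrite starK. Qed.

Lemma tau_linked p q m : F p -> F q -> projection p -> projection q ->
  n%:R ^+ m * tau q = tau p -> linked p q.
Proof.
move=> Fp Fq pp qq pq; have [ps ppp] := pp; have [qs qqq] := qq.
have TT := pow_iso O_cuntz m (i0 n_ge2).
pose f := T ^+ m * p * star (T ^+ m).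
have Ff : F f by apply: F_pow_sandwich gammaP _ _ _ Fp.
have [fs ff] : projection f.
  split; first by rewrite /f !starM starK ps mulrA.
  by rewrite /f -!mulrA isoK // (mulrA p) ppp.
have [w [Fw we wq]] : mvn gamma f q.
  apply: (F_compare n_ge2 O_cuntz gammaP tauP) => //.
  apply: (mulfI (expf_neq0 m (n_neq0 R n_ge2))).
  by rewrite pq (tau_pow n_ge2 O_cuntz gammaP tauP).
exists (w * (T ^+ m * p)); split.
- transitivity (p * star (T ^+ m) * (star w * w) * (T ^+ m * p)).
    by rewrite !starM ps !mulrA.
  by rewrite we /f -!mulrA !isoK // !ppp.
- transitivity (w * (T ^+ m * (p * p) * star (T ^+ m)) * star w).
    by rewrite !starM ps !mulrA.
  by rewrite ppp -/f (pisoR we ff fs).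
- move=> x Fx; have -> : w * (T ^+ m * p) * x * star (w * (T ^+ m * p)) =
      w * (T ^+ m * (p * x * p) * star (T ^+ m)) * star w.
    by rewrite !starM ps !mulrA.
  apply: FM; last exact: F_star.
  by apply: FM => //; apply: (F_pow_sandwich gammaP); apply: FM => //; apply: FM.
- move=> x Fx; have -> : star (w * (T ^+ m * p)) * x * (w * (T ^+ m * p)) =
      p * (star (T ^+ m) * (star w * x * w) * T ^+ m) * p.
    by rewrite !starM ps !mulrA.
  apply: FM => //; apply: FM => //; apply: (F_pow_compress gammaP).
  by apply: FM => //; apply: FM => //; apply: F_star.
Qed.

End Commutant.

(** * The normalizer *)

Section Normalizer.
Context (R : realType) (n : nat) (O : cstarType R) (S : 'I_n -> O)
  (gamma : R[i] -> O -> O) (tau : O -> R[i]) (k : nat) (e : 'I_k -> O).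
Context (n_ge2 : (2 <= n)%N) (O_cuntz : is_cuntz S) (gammaP : gauge_action S gamma)
  (tauP : normalized_trace (fixed_algebra gamma) tau)
  (eF : forall j, fixed_algebra gamma (e j)) (e_proj : forall j, projection (e j))
  (e_neq0 : forall j, e j != 0) (e_sum : \sum_(j < k) e j = 1).
Implicit Types (x y z a b c w p q g : O) (s t : 'S_k) (u : unitary O).

Local Notation F := (fixed_algebra gamma).
Local Notation A := (corner_sum F e).
Local Notation sim := (trace_equiv n tau e).
Let F0 := F0 gammaP.
Let F1 := F1 gammaP.
Let FM := FM gammaP.
Let F_star := F_star gammaP.

Lemma e_star j : star (e j) = e j. Proof. by case: (e_proj j). Qed.
Lemma ee j : e j * e j = e j. Proof. by case: (e_proj j). Qed.

Lemma e_orth i j : i != j -> e i * e j = 0.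
Proof. exact: projections_orthogonal. Qed.

Lemma e_inj : injective e.
Proof.
move=> i j ij; apply/eqP/negPn/negP => /e_orth; rewrite -ij ee => /eqP.
by apply/negP.
Qed.

(** As the commutant of the e_j in F, A is visibly closed under products and adjoints. *)
Lemma corner_sumP x : A x <-> F x /\ forall j, e j * x = x * e j.
Proof.
split=> [[y Fy ->]|[Fx ex]].
  split; first by apply: (F_sum gammaP) => j _; apply: FM => //; apply: FM.
  move=> j; rewrite mulr_sumr mulr_suml; apply: eq_bigr => i _.
  have [->|ij] := eqVneq i j; first by rewrite !mulrA ee -[RHS]mulrA ee.
  by rewrite !mulrA e_orth 1?eq_sym // !mul0r -mulrA e_orth // mulr0.
exists (fun=> x) => //.
by rewrite -[LHS]mulr1 -e_sum mulr_sumr; apply: eq_bigr => j _; rewrite ex -mulrA ee.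
Qed.

Lemma A_F x : A x -> F x. Proof. by case/corner_sumP. Qed.
Lemma A_comm x j : A x -> e j * x = x * e j. Proof. by case/corner_sumP. Qed.
Lemma A_e j : A (e j).
Proof.
apply/corner_sumP; split=> // i; have [->//|ij] := eqVneq i j.
by rewrite !e_orth // eq_sym.
Qed.
Lemma A_1 : A 1.
Proof. by apply/corner_sumP; split=> // j; rewrite mulr1 mul1r. Qed.
Lemma A_mul x y : A x -> A y -> A (x * y).
Proof.
move=> Ax Ay; apply/corner_sumP; split=> [|j]; first by apply: FM; apply: A_F.
by rewrite mulrA A_comm // -mulrA A_comm // mulrA.
Qed.
Lemma A_star x : A x -> A (star x).
Proof.
move=> Ax; apply/corner_sumP; split=> [|j]; first by apply: F_star; apply: A_F.
by rewrite -e_star -!starM A_comm.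
Qed.
Lemma A_corner x j : F x -> A (e j * x * e j).
Proof.
move=> Fx; apply/corner_sumP; split=> [|i]; first by apply: FM => //; apply: FM.
have [->|ij] := eqVneq i j; first by rewrite !mulrA ee -[RHS]mulrA ee.
by rewrite !mulrA e_orth // !mul0r -mulrA e_orth 1?eq_sym // mulr0.
Qed.

Lemma unitary_starL u : star (uval u) * uval u = 1. Proof. by case: u => u /= /andP[/eqP]. Qed.
Lemma unitary_starR u : uval u * star (uval u) = 1. Proof. by case: u => u /= /andP[_ /eqP]. Qed.

Lemma normalizer_conj u x : normalizer_set A u -> A x -> A (uval u * x * star (uval u)).
Proof. by move=> uA Ax; rewrite -uA; exists x. Qed.

Lemma normalizer_conjV u x : normalizer_set A u -> A x -> A (star (uval u) * x * uval u).
Proof.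
move=> uA; rewrite -{1}uA => -[y Ay <-].
by rewrite !mulrA unitary_starL mul1r -mulrA unitary_starL mulr1.
Qed.

Lemma normalizer_setI u : (forall x, A x -> A (uval u * x * star (uval u))) ->
  (forall x, A x -> A (star (uval u) * x * uval u)) -> normalizer_set A u.
Proof.
move=> h h'; apply/seteqP; split=> [_ [x Ax <-]|x Ax]; first exact: h.
by exists (star (uval u) * x * uval u); [exact: h'|rewrite !mulrA unitary_starR mul1r -mulrA unitary_starR mulr1].
Qed.

(* The minimal central projections of A are the e_j. *)
Lemma normalizer_perm u : normalizer_set A u ->
  exists s, forall j, uval u * e j * star (uval u) = e (s j).
Proof.
move=> uA; pose f j := uval u * e j * star (uval u).
have fA j : A (f j) by apply: normalizer_conj => //; apply: A_e.
have fM i j : f i * f j = uval u * (e i * e j) * star (uval u).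
  by rewrite /f -!mulrA (mulrA (star (uval u))) unitary_starL mul1r.
have fs : \sum_j f j = 1 by rewrite /f -mulr_suml -mulr_sumr e_sum mulr1 unitary_starR.
have fcomm j x : A x -> f j * x = x * f j.
  move=> Ax; have := A_comm j (normalizer_conjV uA Ax) => h.
  transitivity (uval u * (e j * (star (uval u) * x * uval u)) * star (uval u)).
    by rewrite /f -!mulrA unitary_starR mulr1.
  by rewrite h /f !mulrA unitary_starR mul1r.
(* Since f_j is central in A, e_i f_j commutes with e_i F e_i, hence is a multiple of e_i; being
   idempotent, it is 0 or e_i. *)
have dich i j : e i * f j = 0 \/ e i * f j = e i.
  have [||x Fx|l lE] := @corner_commutant _ _ _ _ _ _ n_ge2 O_cuntz gammaP tauP (e i) (e i * f j) (eF i) (e_proj i) (e_neq0 i).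
  - by rewrite mulrA ee.
  - by rewrite -mulrA (fcomm _ _ (A_e i)) mulrA ee.
  - have AX := A_corner i Fx; have eX : e i * (e i * x * e i) = e i * x * e i by rewrite !mulrA ee.
    have Xe : e i * x * e i * e i = e i * x * e i by rewrite -mulrA ee.
    by move: (e i * x * e i) AX eX Xe => X AX eX Xe; rewrite -mulrA fcomm // mulrA eX mulrA Xe.
  have : (e i * f j) * (e i * f j) = e i * f j.
    by rewrite -mulrA (mulrA (f j)) (fcomm _ _ (A_e i)) -mulrA fM ee mulrA ee.
  rewrite lE -scalerAl -scalerAr ee scalerA => /eqP.
  rewrite -subr_eq0 -scalerBl scaler_eq0 (negbTE (e_neq0 i)) orbF.
  rewrite -{3}[l]mulr1 -mulrBr mulf_eq0 subr_eq0 => /orP[/eqP ->|/eqP ->].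
    by left; rewrite scale0r.
  by right; rewrite scale1r.
have /choice[r rP] : forall j, exists i, e i * f j = e i.
  move=> j; apply: contrapT => h; move/eqP: (e_neq0 j); apply.
  have f0 : f j = 0.
    rewrite -[LHS]mul1r -e_sum mulr_suml big1 // => i _.
    by case: (dich i j) => // h'; case: h; exists i.
  have : star (uval u) * f j * uval u = e j.
    by rewrite /f !mulrA unitary_starL mul1r -mulrA unitary_starL mulr1.
  by rewrite f0 mulr0 mul0r.
have forth i j : i != j -> f i * f j = 0.
  by move=> ij; rewrite fM e_orth // mulr0 mul0r.
(* An e_i lies under at most one f_j, so the choice r is injective, hence a permutation, and f_j is
   exactly e_(r j). *)
have zero i j j' : j != j' -> e i * f j = e i -> e i * f j' = 0.
  by move=> jj <-; rewrite -mulrA forth // mulr0.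
have rI : injective r.
  move=> j j' jj; apply/eqP/negPn/negP => jn; have /eqP := zero _ _ _ jn (rP j).
  by rewrite jj rP; apply/negP.
exists (perm rI) => j; rewrite -/(f j) permE.
rewrite -[LHS]mul1r -e_sum mulr_suml (bigD1 (r j)) //= big1 ?addr0 ?rP // => i ij.
have [j' jE] : exists j', i = r j'.
  by exists ((perm rI)^-1%g i); rewrite -[r _](permE rI) permKV.
rewrite jE; apply: (zero _ j') => //; apply: contra_neq ij => <-; exact: jE.
Qed.

Lemma tau_e_neq0 j : tau (e j) != 0.
Proof. by rewrite gt_eqF // (F_proj_tau_gt0 n_ge2 O_cuntz gammaP tauP). Qed.

Let nu : (n%:R : R[i]) != 0 := n_neq0 R n_ge2.

Lemma sim_refl i : sim i i.
Proof. by exists 0; rewrite divff ?tau_e_neq0. Qed.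

Lemma sim_sym i j : sim i j -> sim j i.
Proof. by case=> m h; exists (- m); rewrite -invr_expz -h invf_div. Qed.

Lemma sim_trans j i l : sim i j -> sim j l -> sim i l.
Proof.
move=> [m h] [m' h']; exists (m + m'); rewrite expfzDr // -h -h'.
by rewrite mulrA divfK // tau_e_neq0.
Qed.

Lemma sim_tau m i j : n%:R ^+ m * tau (e j) = tau (e i) -> sim i j.
Proof. by move=> h; exists (Posz m); rewrite -h mulfK ?tau_e_neq0. Qed.

Lemma sim_linked i j : sim i j -> linked gamma (e i) (e j).
Proof.
case=> [[m|m] h].
  apply: (tau_linked n_ge2 O_cuntz gammaP tauP (m := m)) => //.
  by rewrite -[_ ^+ m]h divfK // tau_e_neq0.
apply: linked_sym; apply: (tau_linked n_ge2 O_cuntz gammaP tauP (m := m.+1)) => //.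
have {}h : tau (e i) / tau (e j) = (n%:R ^+ m.+1)^-1 by [].
by rewrite -[tau (e i)](divfK (tau_e_neq0 j)) h mulrA mulfV ?mul1r // expf_neq0.
Qed.

Lemma class_permsP s : class_perms_set sim s <-> forall j, sim j (s j).
Proof.
split=> [sP j|sP i].
  have : [set s l | l in [set l | sim j l]] (s j) by exists j => //; apply: sim_refl.
  by rewrite sP.
apply/seteqP; split=> [_ [j ij <-]|j ij]; first exact: sim_trans ij (sP j).
have js : s ((s : 'S_k)^-1%g j) = j by rewrite /sym_fun permKV.
exists ((s : 'S_k)^-1%g j) => //=; apply: sim_trans ij (sim_sym _).
by rewrite -{2}js; apply: sP.
Qed.

Lemma normalizer_transporter u s j : normalizer_set A u ->
  uval u * e j * star (uval u) = e (s j) ->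
  [/\ star (uval u * e j) * (uval u * e j) = e j,
      uval u * e j * star (uval u * e j) = e (s j) &
      forall x, F x -> F (uval u * e j * (e j * x * e j) * star (uval u * e j))].
Proof.
move=> uA us; split.
- by rewrite starM e_star -mulrA (mulrA _ (uval u)) unitary_starL mul1r ee.
- rewrite starM e_star; transitivity (uval u * (e j * e j) * star (uval u)); first by rewrite !mulrA.
  by rewrite ee us.
- move=> x Fx; have -> : uval u * e j * (e j * x * e j) * star (uval u * e j) =
    uval u * (e j * x * e j) * star (uval u).
    rewrite starM e_star.
    transitivity (uval u * (e j * e j * x * (e j * e j)) * star (uval u)); first by rewrite !mulrA.
    by rewrite ee.
  by apply: A_F; apply: normalizer_conj => //; apply: A_corner.
Qed.

Lemma normalizer_sim u s j : normalizer_set A u ->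
  uval u * e j * star (uval u) = e (s j) -> sim j (s j).
Proof.
move=> uA /(normalizer_transporter uA)[h1 h2 h3].
have [m [[_ h]|[_ h]]] := transporter_tau n_ge2 O_cuntz gammaP tauP (eF j) (eF (s j)) (e_proj j)
  (e_proj (s j)) (e_neq0 j) h1 h2 h3.
  exact: sim_tau h.
exact/sim_sym/sim_tau/h.
Qed.

Lemma normalizer_fix u : normalizer_set A u ->
  (forall j, uval u * e j * star (uval u) = e j) -> A (uval u).
Proof.
move=> uA ue; apply/corner_sumP; split=> [|j].
  rewrite -[uval u]mulr1 -e_sum mulr_sumr; apply: (F_sum gammaP) => j _.
  have uj : uval u * e j * star (uval u) = e ((1%g : 'S_k) j) by rewrite perm1.
  have [h1 h2 h3] := normalizer_transporter uA uj; rewrite perm1 in h2.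
  exact: (transporter_F n_ge2 O_cuntz gammaP tauP (eF j) (eF j) (e_proj j) (e_proj j) (e_neq0 j) h1 h2 h3).
by rewrite -{1}ue -mulrA unitary_starL mulr1.
Qed.

(** The choice depends on the predicate [sim j] alone, so equivalent indices share it; the default
    is never reached, as [sim] is reflexive. *)
Definition class_rep j : 'I_k := odflt j [pick i | `[< sim j i >]].

Lemma class_rep_sim j : sim j (class_rep j).
Proof. by rewrite /class_rep; case: pickP => [i /asboolP|_] //=; apply: sim_refl. Qed.

Lemma class_rep_eq i j : sim i j -> class_rep i = class_rep j.
Proof.
move=> ij; rewrite /class_rep.
rewrite (@eq_pick _ _ (fun l => `[< sim j l >])).
  by case: pickP => // /(_ j); rewrite asboolT //; apply: sim_refl.
move=> l; apply/asboolP/asboolP; last exact: sim_trans.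
exact/sim_trans/sim_sym.
Qed.

Lemma class_frame : exists v : 'I_k -> O, forall j,
  [/\ star (v j) * v j = e (class_rep j), v j * star (v j) = e j,
      (forall x, F x -> F (v j * x * star (v j))) & (forall x, F x -> F (star (v j) * x * v j))].
Proof.
have /choice[v vP] : forall j, linked gamma (e (class_rep j)) (e j).
  by move=> j; apply/sim_linked/sim_sym/class_rep_sim.
by exists v.
Qed.

(** * Unitaries that implement the class-preserving permutations *)

Section ClassUnitary.
Context (v : 'I_k -> O)
  (vP : forall j, [/\ star (v j) * v j = e (class_rep j), v j * star (v j) = e j,
      (forall x, F x -> F (v j * x * star (v j))) & (forall x, F x -> F (star (v j) * x * v j))]).

Lemma ev j : e j * v j = v j.
Proof. by case: (vP j) => _ h _ _; apply: pisoL h _ _; [apply: ee|apply: e_star]. Qed.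

Lemma v_rep j : v j * e (class_rep j) = v j.
Proof. by case: (vP j) => h _ _ _; apply: pisoR h _ _; [apply: ee|apply: e_star]. Qed.

Lemma ve j : star (v j) * e j = star (v j).
Proof. by rewrite -{1}e_star -starM ev. Qed.

Lemma v_orth i j : i != j -> star (v i) * v j = 0.
Proof. by move=> ij; rewrite -ve -(ev j) -mulrA (mulrA (e i)) e_orth // mul0r mulr0. Qed.

Definition class_sum s : O := \sum_j v (s j) * star (v j).

Lemma class_sum1 : class_sum 1%g = 1.
Proof.
rewrite -e_sum; apply: eq_bigr => j _; rewrite perm1; by case: (vP j).
Qed.

Lemma class_sum_v s j : class_sum s * v j = v (s j) * e (class_rep j).
Proof.
rewrite /class_sum mulr_suml (bigD1 j) //= big1 ?addr0 => [|i ij].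
  by rewrite -mulrA; case: (vP j) => ->.
by rewrite -mulrA v_orth // mulr0.
Qed.

(** In v_{s t j} v_{t j}^* v_{t j} v_j^* the middle factor is the projection of the representative
    of t j, which is that of j and is absorbed by v_j^*. The product [t * s] of 'S_k applies t
    first. *)
Lemma class_sumM s t : (forall j, sim j (t j)) ->
  class_sum s * class_sum t = class_sum (t * s)%g.
Proof.
move=> tP; rewrite [class_sum t]/class_sum mulr_sumr; apply: eq_bigr => j _.
rewrite mulrA class_sum_v permM -(class_rep_eq (tP j)) -mulrA; congr (_ * _).
by rewrite -{1}e_star -starM v_rep.
Qed.

Lemma class_sum_star s : star (class_sum s) = class_sum s^-1%g.
Proof.
rewrite /class_sum star_sum (reindex_inj (@perm_inj _ s^-1%g)) /=.
by apply: eq_bigr => j _; rewrite starM starK permKV.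
Qed.

Lemma class_permsV s : (forall j, sim j (s j)) -> forall j, sim j (s^-1%g j).
Proof. by move=> sP j; apply: sim_sym; rewrite -{2}(permKV s j). Qed.

Lemma class_sum_unitary s : (forall j, sim j (s j)) ->
  (star (class_sum s) * class_sum s == 1) && (class_sum s * star (class_sum s) == 1).
Proof.
move=> sP; rewrite class_sum_star !class_sumM //; last exact: class_permsV.
by rewrite mulgV mulVg class_sum1 eqxx.
Qed.

Lemma class_sum_e s j : (forall j, sim j (s j)) ->
  class_sum s * e j * star (class_sum s) = e (s j).
Proof.
move=> sP; case: (vP j) => _ <- _ _; rewrite mulrA class_sum_v (class_rep_eq (sP j)).
rewrite v_rep -mulrA -starM class_sum_v (class_rep_eq (sP j)) v_rep.
by case: (vP (s j)).
Qed.

Lemma class_sum_A s x : (forall j, sim j (s j)) -> A x ->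
  A (class_sum s * x * star (class_sum s)).
Proof.
move=> sP Ax; have Fx := A_F Ax; apply/corner_sumP; split.
  rewrite /class_sum star_sum !mulr_suml; apply: (F_sum gammaP) => j _.
  rewrite mulr_sumr; apply: (F_sum gammaP) => i _.
  have [->|ij] := eqVneq i j.
    have -> : v (s j) * star (v j) * x * star (v (s j) * star (v j)) =
        v (s j) * (star (v j) * x * v j) * star (v (s j)).
      by rewrite starM starK !mulrA.
    case: (vP (s j)) => _ _ h _; case: (vP j) => _ _ _ h'; exact/h/h'.
  (* Off the diagonal the factor e_j x e_i vanishes, because x commutes with e_i. *)
  rewrite starM starK -ve -(ev i).
  have -> : v (s j) * (star (v j) * e j) * x * (e i * v i * star (v (s i))) =
      v (s j) * star (v j) * (e j * (x * e i)) * v i * star (v (s i)).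
    by rewrite !mulrA.
  rewrite -(A_comm i Ax) (mulrA (e j)) e_orth 1?eq_sym // !(mul0r, mulr0); exact: F0.
move=> j; have /andP[/eqP cc _] := class_sum_unitary sP.
have -> : e j = class_sum s * e (s^-1%g j) * star (class_sum s).
  by rewrite class_sum_e // permKV.
move: (class_sum s) cc => C cc.
transitivity (C * (e (s^-1%g j) * x) * star C); first by rewrite -!mulrA isoK.
by rewrite (A_comm _ Ax) -!mulrA isoK.
Qed.

End ClassUnitary.

End Normalizer.

(** * The normalizer as a semidirect product *)

Theorem theorem4 (R : realType) (n : nat) (O : cstarType R) (S : 'I_n -> O)
    (gamma : R[i] -> O -> O) (tau : O -> R[i]) (k : nat) (e : 'I_k -> O)
    (n_ge2 : (2 <= n)%N)
    (O_cuntz : is_cuntz S)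
    (gammaP : gauge_action S gamma)
    (tauP : normalized_trace (fixed_algebra gamma) tau)
    (eF : forall j, fixed_algebra gamma (e j))
    (e_proj : forall j, projection (e j))
    (e_neq0 : forall j, e j != 0)
    (e_sum : \sum_(j < k) e j = 1) :
  let A := corner_sum (fixed_algebra gamma) e in
  let S_sim := class_perms (trace_equiv n tau e) in
  exists U_A : subgroup (unitary O), U_A = unitaries_in A :> set (unitary O) /\
  exists V : {multiplicative S_sim -> normalizer A},
  let v (s : S_sim) : O := uval (subgroup_val (V s)) in
    (forall (s : S_sim) (j : 'I_k), v s * e j * star (v s) = e (subgroup_val s j)) /\
  exists alpha : group_action U_A S_sim,
    (forall (s : S_sim) (u : U_A),
       uval (subgroup_val (alpha s u)) = v s * uval (subgroup_val u) * star (v s)) /\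
  exists Phi : {multiplicative semidirect alpha -> normalizer A},
    bijective Phi /\
    (forall (u : U_A) (s : S_sim),
       uval (subgroup_val (Phi (u, s))) = uval (subgroup_val u) * v s).
Proof.
move=> A S_sim.
have AP := corner_sumP gammaP eF e_proj e_sum.
have A1 : A 1 by apply: A_1 gammaP eF e_proj e_sum.
have AM : forall x y, A x -> A y -> A (x * y) by apply: A_mul gammaP eF e_proj e_sum.
have AS : forall x, A x -> A (star x) by apply: A_star gammaP eF e_proj e_sum.
have gA : group_closed (mem (unitaries_in A)).
  split=> [|u w]; rewrite ?inE; first exact: A1.
  by rewrite /unitaries_in /= => Au Aw; apply: AM => //; apply: AS.
exists (Subgroup gA); split=> //.
have [v vP] := class_frame n_ge2 O_cuntz gammaP tauP eF e_proj e_neq0.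
have sP (s : S_sim) j : trace_equiv n tau e j (subgroup_val s j).
  have := subgroup_valP s; rewrite inE => /(class_permsP n_ge2 O_cuntz gammaP tauP eF e_proj e_neq0).
  exact.
pose Vu (s : S_sim) : unitary O := Unitary
  (class_sum_unitary n_ge2 O_cuntz gammaP tauP eF e_proj e_neq0 e_sum vP (sP s)).
have VuM : {morph Vu : s t / (s * t)%g}.
  move=> s t; apply: val_inj; apply/esym.
  by apply: (class_sumM n_ge2 O_cuntz gammaP tauP eF e_proj e_neq0 e_sum vP); apply: sP.
have VuA s x : A x -> A (uval (Vu s) * x * star (uval (Vu s))).
  exact: (class_sum_A n_ge2 O_cuntz gammaP tauP eF e_proj e_neq0 e_sum vP (sP s)).
have VuV s : (Vu s)^-1%g = Vu s^-1%g.
  have Vu1 : Vu 1%g = 1%g by apply: (mulgI (Vu 1%g)); rewrite -VuM !mulg1.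
  by apply: (mulgI (Vu s)); rewrite mulgV -VuM mulgV Vu1.
have VuAV s x : A x -> A (star (uval (Vu s)) * x * uval (Vu s)).
  move=> Ax; have := VuA s^-1%g _ Ax; rewrite -VuV.
  by rewrite [uval _]/= starK.
have VN s : Vu s \in normalizer_set A.
  by rewrite inE; apply: normalizer_setI => x Ax; [apply: VuA|apply: VuAV].
have VE s j : uval (Vu s) * e j * star (uval (Vu s)) = e (subgroup_val s j).
  exact: (class_sum_e n_ge2 O_cuntz gammaP tauP eF e_proj e_neq0 e_sum vP j (sP s)).
pose V0 (s : S_sim) : normalizer A := @SubgroupElt _ (normalizer A) (Vu s) (VN s).
have V0M : {morph V0 : s t / (s * t)%g} by move=> s t; apply: val_inj; apply: VuM.
pose V : {multiplicative S_sim -> normalizer A} :=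
  HB.pack V0 (isMultiplicative.Build _ _ V0 V0M).
exists V => w; split; first exact: VE.
pose U : subgroup (unitary O) := Subgroup gA.
have UA (u : U) : A (uval (subgroup_val u)) by have := subgroup_valP u; rewrite inE.
have aU s (u : U) : (Vu s * subgroup_val u * (Vu s)^-1)%g \in unitaries_in A.
  by rewrite inE; apply: VuA.
pose alpha0 s (u : U) : U := @SubgroupElt _ U _ (aU s u).
have alphaM s : {morph alpha0 s : x y / (x * y)%g}.
  by move=> x y; apply: val_inj; rewrite /= !mulgA mulgKV.
have alpha1 x : alpha0 1%g x = x.
  apply: val_inj; rewrite /=; have -> : Vu 1%g = 1%g.
    by apply: (mulgI (Vu 1%g)); rewrite -VuM !mulg1.
  by rewrite mul1g invg1 mulg1.
have alphaC s t x : alpha0 (s * t)%g x = alpha0 s (alpha0 t x).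
  by apply: val_inj; rewrite /= VuM invgM !mulgA.
pose alpha : group_action U S_sim := @Defs.GroupAction _ _  alpha0 alphaM alpha1 alphaC.
exists alpha; split=> //.
have UN (u : U) : subgroup_val u \in normalizer_set A.
  have Au := UA u; have Aus := AS _ Au.
  by rewrite inE; apply: normalizer_setI => x Ax; do 2?apply/AM.
have PN (p : semidirect alpha) : (subgroup_val p.1 * Vu p.2)%g \in normalizer_set A.
  exact: group_closedM (normalizer_group A) _ _ (UN _) (VN _).
pose Phi0 (p : semidirect alpha) : normalizer A := @SubgroupElt _ (normalizer A) _ (PN p).
have Phi0M : {morph Phi0 : p q / (p * q)%g}.
  by move=> [u s] [u' s']; apply: val_inj; rewrite /= VuM !mulgA mulgKV.
pose Phi : {multiplicative semidirect alpha -> normalizer A} :=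
  HB.pack Phi0 (isMultiplicative.Build _ _ Phi0 Phi0M).
exists Phi; split=> //.
have PhiI : injective Phi0.
  move=> [u s] [u' s'] /(congr1 (fun p => subgroup_val p)) /= E.
  (* A unitary of A commutes with the e_j, so x V_t permutes them by t; this recovers t from the
     product. *)
  have conj (t : S_sim) (x : U) j :
      uval (subgroup_val x * Vu t)%g * e j * star (uval (subgroup_val x * Vu t)%g) = e (subgroup_val t j).
    rewrite /= starM -!mulrA (mulrA (uval (Vu t)) (e j)) (mulrA _ (star (uval (Vu t)))) VE.
    by have /AP[_ h] := UA x; rewrite mulrA -h -mulrA unitary_starR mulr1.
  have ss : s = s'.
    apply: val_inj; apply/permP => j; apply: (e_inj e_proj e_neq0 e_sum).
    by have := conj s u j; rewrite E conj => ->.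
  rewrite -{}ss in E *; congr (_, _); apply: val_inj; exact: mulIg E.
have PhiS : forall w, exists p, Phi0 p = w.
  move=> [u uN]; have uA : normalizer_set A u by rewrite inE in uN.
  have [s sE] := normalizer_perm n_ge2 O_cuntz gammaP tauP eF e_proj e_neq0 e_sum uA.
  have sS : (s : sym k) \in class_perms_set (trace_equiv n tau e).
    rewrite inE; apply/(class_permsP n_ge2 O_cuntz gammaP tauP eF e_proj e_neq0) => j.
    exact: (normalizer_sim n_ge2 O_cuntz gammaP tauP eF e_proj e_neq0 e_sum uA (sE j)).
  pose s' : S_sim := @SubgroupElt _ S_sim s sS.
  have rN : (u * (Vu s')^-1)%g \in normalizer_set A.
    by case: (normalizer_group A) => _; apply.
  (* Both u and V_{s'} carry e_j to e_(s j), so the quotient fixes every e_j and lies in A by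
     [normalizer_fix]. *)
  have rU : (u * (Vu s')^-1)%g \in unitaries_in A.
    rewrite inE; apply: (normalizer_fix n_ge2 O_cuntz gammaP tauP eF e_proj e_neq0 e_sum).
      by rewrite inE in rN.
    have VV : star (uval (Vu s')) * uval (Vu s') = 1 := unitary_starL (Vu s').
    move=> j; have si : s ((s^-1)%g j) = j by rewrite permKV.
    rewrite -{1}si -(VE s') [uval (u * _)%g]/= -/(uval (Vu s')) starM starK.
    by rewrite -!mulrA !isoK // mulrA sE si.
  exists (@SubgroupElt _ U _ rU, s'); apply: val_inj => /=.
  by rewrite mulgKV.
have /choice[g gP] := PhiS.
by exists g => // p; apply: PhiI; rewrite gP.
Qed.
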